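(* For every $\varepsilon>0$ there is a constant $C_\varepsilon$ such that for every set $S$ of $n$ points in $\mathbb{R}^3$ and every point $a\in S$, the number of triangles with vertices in $S$, having $a$ as a vertex, and having area equal to the maximum area among all triangles with vertices in $S$, is at most $C_\varepsilon n^{4/3+\varepsilon}$.
   Context: A triangle spanned by $S$ is an unordered triple of points of $S$.
   Formalization: Triangles are taken to be non-degenerate (three non-collinear points): for S on a line all triples have the maximum area 0 and the bound fails; if S is not contained in a line, the count is unchanged. *)

(* Defs.v *)
From mathcomp Require Import all_boot all_order all_algebra finmap.
From mathcomp Require Import all_classical all_reals all_analysis.
From mathcomp Require Import ring.

Set Implicit Arguments.
Unset Strict Implicit.
Unset Printing Implicit Defensive.

Import Order.TTheory GRing.Theory Num.Theory.

Local Open Scope ring_scope.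

Section TriangleArea.
Variable R : realType.
Implicit Types (u v p q r : 'rV[R]_3) (S T : {fset 'rV[R]_3}).

(* The norm `|u| of the library on 'rV[R]_3 is the sup norm. *)
Definition enorm u : R := Num.sqrt (\sum_i u 0 i ^+ 2).

(* Coordinates are indexed by 'I_3, i.e. modulo 3. *)
Definition cross u v : 'rV[R]_3 :=
  \row_(k < 3) (u 0 (k + 1) * v 0 (k + 2) - u 0 (k + 2) * v 0 (k + 1)).

Definition area3 p q r : R := enorm (cross (q - p) (r - p)) / 2.

(* Only meaningful for #|` T| = 3; it does not depend on the enumeration of T,
   see area_fset3. *)
Definition area T : R :=
  let s := enum_fset T in area3 (nth 0 s 0) (nth 0 s 1) (nth 0 s 2).

Definition collinear T : Prop :=
  exists p v, forall x, x \in T -> exists t : R, x = p + t *: v.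

(* Collinear triples are not triangles: for S contained in a line they would
   all have the (then maximum) area 0. *)
Definition triangle S T : Prop :=
  [/\ (T `<=` S)%fset, #|` T| = 3%N & ~ collinear T].

Definition max_area_triangle S T : Prop :=
  triangle S T /\ forall T', triangle S T' -> area T' <= area T.

Definition max_area_triangles_at S (a : 'rV[R]_3) : {fset {fset 'rV[R]_3}} :=
  [fset T in fpowerset S | `[< max_area_triangle S T >] && (a \in T)]%fset.

Lemma enormN u : enorm (- u) = enorm u.
Proof.
by congr Num.sqrt; apply: eq_bigr => i _; rewrite mxE sqrrN.
Qed.

Lemma area3_swap12 p q r : area3 q p r = area3 p q r.
Proof.
congr (_ / 2); rewrite -enormN; congr enorm; apply/rowP => k.
by rewrite !mxE; ring.
Qed.

Lemma area3_swap23 p q r : area3 p r q = area3 p q r.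
Proof.
congr (_ / 2); rewrite -enormN; congr enorm; apply/rowP => k.
by rewrite !mxE; ring.
Qed.

Lemma area_fset3 p q r : uniq [:: p; q; r] ->
  area [fset p; q; r]%fset = area3 p q r.
Proof.
move=> pqr.
have : perm_eq (enum_fset [fset p; q; r]%fset) [:: p; q; r].
  apply: uniq_perm => // x.
  by rewrite !inE orbA.
rewrite /area; set s := enum_fset _ => sE.
have := perm_size sE; case: s sE => [|x [|y [|z [|? ?]]]] //= sE _.
have :
  [\/ [/\ x = p, y = q & z = r], [/\ x = p, y = r & z = q],
      [/\ x = q, y = p & z = r] | [\/ [/\ x = q, y = r & z = p],
      [/\ x = r, y = p & z = q] | [/\ x = r, y = q & z = p]]].
  have ux : uniq [:: x; y; z] by rewrite (perm_uniq sE).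
  have m := perm_mem sE.
  have := m x; have := m y; have := m z.
  rewrite !inE !eqxx !orbT /= => /esym/or3P zE /esym/or3P yE /esym/or3P xE.
  move: ux; rewrite /= !inE negb_or andbT => /andP[/andP[xy xz] yz].
  by case: xE xy xz => /eqP-> xy xz; case: yE xy yz => /eqP-> xy yz;
    rewrite ?eqxx // in xy; case: zE xz yz => /eqP-> xz yz;
    rewrite ?eqxx // in xz yz;
    do ?[by constructor 1|by constructor 2|by constructor 3
        |by constructor 4; constructor 1|by constructor 4; constructor 2
        |by constructor 4; constructor 3].
move=> [[-> -> ->]|[-> -> ->]|[-> -> ->]|[[-> -> ->]|[-> -> ->]|[-> -> ->]]] //.
- by rewrite area3_swap23.
- by rewrite area3_swap12.
- by rewrite area3_swap23 area3_swap12.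
- by rewrite area3_swap12 area3_swap23.
- by rewrite area3_swap12 area3_swap23 area3_swap12.
Qed.

End TriangleArea.

(* Main.v *)
Require Import Defs.
From mathcomp Require Import all_boot all_order all_algebra.
From mathcomp Require Import zify.

Set Implicit Arguments.
Unset Strict Implicit.
Unset Printing Implicit Defensive.

Import Order.TTheory GRing.Theory Num.Theory.

(** Put the origin at [a]. Maximum area triangles at [a] are the pairs (b, c)
    with |b x c| maximal, i.e. c lies on the cylinder of axis [b] whose interior
    contains all the points; so we count incidences on the boundary of an
    intersection of cylinders. On the cylinder of a fixed [rho], the other
    cylinders cut out a region between an upper and a lower envelope of functions
    of the angle, any two of which cross boundedly often; by a
    Davenport-Schinzel type estimate these envelopes have quasi-linear
    complexity. This gives a weak bound on the incidences (double counting), and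
    also a decomposition of the region below a sample of r cylinders into about
    r^2 cells; if the sample hits every large conflict set, each cell meets
    about n/r cylinders. The weak bound inside the cells, with
    r about n^(1/3), yields n^(4/3) up to polylogarithmic factors. *)

(** * Alternating words *)

Section Alternation.
Variable T : finType.
Implicit Types (E : nat -> T -> bool) (a b x : T).

(** Double counting alone gives about n^(3/2). With k about n^(1/3), a sample of about k points (up
    to logarithms) leaves about k^2 cells, each meeting at most k^2 cylinders; the weak bound, of
    order k^2 + k m for a cell with m points, then sums to about k^4. Comparing |b x c| with |rho x
    c| is insensitive to the scale of c. So every c can be projected radially to the boundary of the
    intersection of the sampled cylinders, and gets a cell whether or not it lies on one of them. A
    cell must be named by few points, or too many conflict sets would have to be hit. Hence
    meridians are not cut at the breakpoints of the envelopes but into dyadic blocks, and the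
    maximal blocks with short envelopes are kept. The sample is found greedily, without probability.
    Two envelope curves cross boundedly often because eliminating the height leaves a nonzero
    polynomial, except for parallel vectors. Opposite vectors are therefore merged beforehand, at
    the price of a factor 4. *)

Fixpoint alternates E k lo a b : Prop :=
  if k is k'.+1 then
    exists i, [/\ lo <= i, E i a & alternates E k' i.+1 b a]
  else True.

Lemma alternates_sub E E' k lo a b : (forall i x, E i x -> E' i x) ->
  alternates E k lo a b -> alternates E' k lo a b.
Proof.
move=> sEE'; elim: k lo a b => //= k IHk lo a b [i [lo_i Eia]] /IHk alt.
by exists i; split => //; apply: sEE'.
Qed.

Lemma alternates_shift E k N lo a b :
  alternates (fun i => E (N + i)) k lo a b -> alternates E k (N + lo) a b.
Proof.
elim: k lo a b => //= k IHk lo a b [i [lo_i Eia]] /IHk alt.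
by exists (N + i); split; rewrite ?leq_add2l -?addnS.
Qed.

(** Whichever letter is due after the [k] steps still occurs at or beyond [N], so one more step is
    always possible. *)
Lemma alternates_rcons E k N lo a b : lo <= N ->
  (exists2 i, N <= i & E i a) -> (exists2 i, N <= i & E i b) ->
  alternates (fun i x => (i < N) && E i x) k lo a b -> alternates E k.+1 lo a b.
Proof.
elim: k lo a b => [|k IHk] lo a b lo_N aN bN.
  by case: aN => i Ni Eia _; exists i; split => //; apply: leq_trans Ni.
case=> i [lo_i /andP[iN Eia] alt]; exists i; split => //.
exact: IHk alt.
Qed.

Lemma alternates_seq E k lo a b : alternates E k lo a b ->
  exists f : nat -> nat, forall j, j < k ->
    [/\ E (f j) (if odd j then b else a), lo <= f j & j.+1 < k -> f j < f j.+1].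
Proof.
elim: k lo a b => [|k IHk] lo a b /=; first by exists (fun=> 0).
case=> i [lo_i Eia /IHk[f fP]].
exists (fun j => if j is j'.+1 then f j' else i) => -[|j] jk.
  by split => // k1; case: (fP 0 k1).
have [fE fi flt] := fP j jk; split => //=.
- by move: fE; case: (odd j).
- exact: leq_trans (leq_trans lo_i (leqnSn i)) fi.
Qed.

Definition letters N E : {set T} := [set x | has (fun i => E i x) (iota 0 N)].
Definition occurrences N E := \sum_(0 <= i < N) #|[set x | E i x]|.
(** Unlike in a Davenport-Schinzel word, neighbouring positions may repeat a letter, and a position
    may hold several letters. The number of non-empty positions pays for the repetitions. *)
Definition occupied N E := \sum_(0 <= i < N) [exists x, E i x].

Lemma lettersP N E x :
  reflect (exists2 i, i < N & E i x) (x \in letters N E).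
Proof.
rewrite inE; apply: (iffP hasP) => -[i].
  by rewrite mem_iota => iN Eix; exists i.
by move=> iN Eix; exists i; rewrite ?mem_iota.
Qed.

Lemma occupied_sub N E E' : (forall i x, E i x -> E' i x) ->
  occupied N E <= occupied N E'.
Proof.
move=> sEE'; apply: leq_sum => i _; case: (existsP (P := E i)) => // -[x Eix].
by have -> : [exists x, E' i x] by apply/existsP; exists x; apply: sEE'.
Qed.

(** Letters at two different positions must coincide. So either one position is occupied or one
    letter occurs at all; the two terms of the bound cover these two cases. *)
Lemma occurrences_unalternating N E : (forall i x, E i x -> i < N) ->
  (forall a b, a != b -> ~ alternates E 2 0 a b) ->
  occurrences N E <= #|letters N E| + occupied N E.
Proof.
move=> EN alt.
have altE i j x y : i < j -> E i x -> E j y -> x = y.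
  move=> ij Eix Ejy; apply/eqP/negPn/negP => /alt; apply.
  by exists i; split => //; exists j.
case: (pickP [pred i : 'I_N | [exists x, E i x] &&
    [exists j : 'I_N, (i < j) && [exists x, E j x]]]) => [i /=|none].
  case/andP => /existsP[x Eix] /existsP[j /andP[ij /existsP[y Ejy]]].
  have xy := altE _ _ _ _ ij Eix Ejy.
  have allx k z : E k z -> z = x.
    move=> Ekz; case: (leqP k i) => ki.
      by rewrite xy; apply: altE Ekz Ejy; apply: leq_ltn_trans ij.
    by apply/esym; apply: altE Eix Ekz.
  apply: leq_trans (leq_addl _ _); apply: leq_sum => k _.
  case: existsP => [_|nE].
    apply: (@leq_trans #|[set x]|); last by rewrite cards1.
    apply/subset_leq_card/subsetP => z.
    by rewrite !inE => /allx ->.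
  rewrite leqn0 cards_eq0; apply/eqP/setP => z; rewrite !inE.
  by apply/negP => Ekz; apply: nE; exists z.
apply: leq_trans (leq_addr _ _).
case: (pickP [pred i : 'I_N | [exists x, E i x]]) => [i /= iE|noE].
  have only k : k < N -> k != i -> [set x | E k x] = set0.
    move=> kN ki; apply/setP => z; rewrite !inE; apply/negP => Ekz.
    have kE : [exists x, E k x] by apply/existsP; exists z.
    case: (ltngtP k i) ki => // ki _.
      have := none (Ordinal kN); rewrite /= kE /=.
      by move/negbT/existsPn/(_ i); rewrite ki iE.
    have := none i; rewrite /= iE /=.
    by move/negbT/existsPn/(_ (Ordinal kN)); rewrite /= ki kE.
  rewrite /occurrences (bigD1_seq (i : nat)) ?mem_index_iota ?iota_uniq //=.
  rewrite big1_seq ?addn0; last first.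
    by move=> k /andP[ki]; rewrite mem_index_iota /= => kN; rewrite only ?cards0.
  apply/subset_leq_card/subsetP => x; rewrite inE => Eix.
  by apply/lettersP; exists i.
rewrite /occurrences big1_seq // => k /andP[_]; rewrite mem_index_iota /= => kN.
apply/eqP; rewrite cards_eq0; apply/eqP/setP => z; rewrite !inE.
apply/negP => Ekz; have := noE (Ordinal kN).
by move=> /= /negbT/existsPn/(_ z); rewrite Ekz.
Qed.

(* A letter occurring in both halves can be appended to any alternation inside
   one half, so those letters alternate one time less there; the other letters
   live in a single half. *)
Lemma occurrences_alternating s L E : (forall i x, E i x -> i < 2 ^ L) ->
  (forall a b, a != b -> ~ alternates E s.+2 0 a b) ->
  occurrences (2 ^ L) E <=
    (#|letters (2 ^ L) E| + occupied (2 ^ L) E) * (1 + 2 * L) ^ s.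
Proof.
elim: s L E => [|s IHs] L E.
  by move=> EN /(occurrences_unalternating EN); rewrite muln1.
elim: L E => [|L IHL] E EN alt.
  rewrite exp1n muln1 /occurrences expn0 big_nat1.
  apply: leq_trans (leq_addr _ _); apply/subset_leq_card/subsetP => x.
  by rewrite inE => Eix; apply/lettersP; exists 0.
set N := 2 ^ L; have N2 : 2 ^ L.+1 = N + N by rewrite expnS mul2n addnn.
pose El i x := (i < N) && E i x; pose Er i x := E (N + i) x.
have ErN i x : Er i x -> i < N by move/EN; rewrite N2 ltn_add2l.
set A := letters N El; set B := letters N Er.
have AP x : reflect (exists2 i, i < N & E i x) (x \in A).
  apply: (iffP (lettersP _ _ _)) => -[i iN].
    by move=> /andP[_ Eix]; exists i.
  by move=> Eix; exists i => //; apply/andP.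
have BP x : reflect (exists2 i, N <= i & E i x) (x \in B).
  apply: (iffP (lettersP _ _ _)) => -[i iN].
    by move=> Eix; exists (N + i) => //; apply: leq_addr.
  move=> Eix; exists (i - N); last by rewrite /Er subnKC.
  by apply: (ErN _ x); rewrite /Er subnKC.
pose E1 i x := El i x && (x \notin B); pose E3 i x := El i x && (x \in B).
pose E2 i x := Er i x && (x \notin A); pose E4 i x := Er i x && (x \in A).
have split_occ E0 (X : {set T}) : occurrences N E0 =
    occurrences N (fun i x => E0 i x && (x \notin X)) +
    occurrences N (fun i x => E0 i x && (x \in X)).
  rewrite -big_split; apply: eq_bigr => i _ /=.
  rewrite -(cardsID X) addnC; congr (_ + _); apply: eq_card => x; rewrite !inE //.
  by rewrite andbC.
have shift (G : nat -> nat) : \sum_(N <= i < N + N) G i = \sum_(0 <= i < N) G (N + i).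
  rewrite -{1}(add0n N) big_addn addnK.
  by apply: eq_bigr => i _; rewrite addnC.
have occE : occurrences (2 ^ L.+1) E =
    (occurrences N E1 + occurrences N E2) + (occurrences N E3 + occurrences N E4).
  rewrite addnACA -(split_occ El B) -(split_occ Er A) /occurrences N2.
  rewrite (big_cat_nat (n := N)) ?leq_addr //=; congr (_ + _).
    apply: eq_big_nat => i /= iN; apply: eq_card => x; rewrite !inE /El.
    by rewrite iN.
  exact: shift.
have posE : occupied N El + occupied N Er = occupied (2 ^ L.+1) E.
  rewrite [RHS]/occupied N2 [RHS](big_cat_nat (n := N)) ?leq_addr //=.
  congr (_ + _).
    apply: eq_big_nat => i /= iN; congr nat_of_bool.
    by apply: eq_existsb => x; rewrite /El iN.
  exact/esym/shift.
have altl E0 : (forall i x, E0 i x -> El i x) ->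
    forall k lo a b, alternates E0 k lo a b -> alternates E k lo a b.
  by move=> s0 k lo a b; apply: alternates_sub => i x /s0 /andP[].
have altr E0 : (forall i x, E0 i x -> Er i x) ->
    forall k a b, alternates E0 k 0 a b -> alternates E k N a b.
  move=> s0 k a b /(alternates_sub s0) /(@alternates_shift E).
  by rewrite addn0.
have weaken k lo a b : alternates E k lo a b -> alternates E k 0 a b.
  by case: k => //= k [i [_ Eia ?]]; exists i.
have s1 i x : E1 i x -> El i x by case/andP.
have s2 i x : E2 i x -> Er i x by case/andP.
have s3 i x : E3 i x -> El i x by case/andP.
have s4 i x : E4 i x -> Er i x by case/andP.
have elN E0 i x : (forall i x, E0 i x -> El i x) -> E0 i x -> i < N.
  by move=> s0 /s0 /andP[].
have le1 := IHL E1 (fun i x => elN _ i x s1)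
  (fun a b ab h => alt a b ab (altl _ s1 _ _ _ _ h)).
have le2 := IHL E2 (fun i x h => ErN _ _ (s2 i x h))
  (fun a b ab h => alt a b ab (weaken _ _ _ _ (altr _ s2 _ _ _ h))).
have le3 : occurrences N E3 <=
    (#|letters N E3| + occupied N E3) * (1 + 2 * L) ^ s.
  apply: IHs => [i x|a b ab h]; first exact: elN s3.
  case: (h) => i [_ /andP[_ aB] [j [_ /andP[_ bB] _]]].
  apply: (alt a b ab); apply: (@alternates_rcons _ _ N).
  - by [].
  - exact/BP.
  - exact/BP.
  - by apply: alternates_sub h => k x /s3.
have le4 : occurrences N E4 <=
    (#|letters N E4| + occupied N E4) * (1 + 2 * L) ^ s.
  apply: IHs => [i x|a b ab h]; first by move=> /s4; apply: ErN.
  case: (h) => i [_ /andP[_ aA] [j [_ /andP[_ /AP[k kN Ekb]] _]]].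
  (* In the right half a letter is prepended: an occurrence of [b] in the left half comes before the
     word starting with [a], so the letters swap roles. *)
  have ba : b != a by rewrite eq_sym.
  apply: (alt b a ba); exists k; split => //.
  have := altr _ s4 _ _ _ h; case=> l [Nl Ela rest]; exists l; split => //.
  exact: leq_trans kN Nl.
have lets1 : #|letters N E1| <= #|A :\: B|.
  apply/subset_leq_card/subsetP => x /lettersP[i iN /andP[Elx xB]].
  by rewrite in_setD xB; apply/lettersP; exists i.
have lets2 : #|letters N E2| <= #|B :\: A|.
  apply/subset_leq_card/subsetP => x /lettersP[i iN /andP[Elx xB]].
  by rewrite in_setD xB; apply/lettersP; exists i.
have lets3 : #|letters N E3| <= #|A :&: B|.
  apply/subset_leq_card/subsetP => x /lettersP[i iN /andP[Elx xB]].
  by rewrite in_setI xB andbT; apply/lettersP; exists i.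
have lets4 : #|letters N E4| <= #|A :&: B|.
  apply/subset_leq_card/subsetP => x /lettersP[i iN /andP[Elx xB]].
  by rewrite in_setI xB; apply/lettersP; exists i.
have letsE : #|A :\: B| + #|B :\: A| + #|A :&: B| <= #|letters (2 ^ L.+1) E|.
  have sAB : A :|: B \subset letters (2 ^ L.+1) E.
    apply/subsetP => x; rewrite inE => /orP[/AP|/BP] [i _ Eix];
      by apply/lettersP; exists i => //; apply: EN Eix.
  apply: leq_trans (subset_leq_card sAB).
  have := cardsID B A; have := cardsID A B; have := cardsUI A B.
  rewrite [B :&: A]setIC; lia.
have pos1 := occupied_sub N s1; have pos2 := occupied_sub N s2.
have pos3 := occupied_sub N s3; have pos4 := occupied_sub N s4.
rewrite occE -posE; set c := 1 + 2 * L.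
(* Letters living in one half cost [c ^ s.+1]; common letters are counted in both halves, hence
   [2 * c ^ s]. *)
have cS : c ^ s.+1 + 2 * c ^ s <= (1 + 2 * L.+1) ^ s.+1.
  rewrite [c ^ _]expnS -mulnDl expnS.
  have -> : c + 2 = 1 + 2 * L.+1 by rewrite /c; lia.
  rewrite leq_mul2l; apply/orP; right; case: (s) => // s'.
  by rewrite leq_exp2r // /c; lia.
apply: leq_trans (_ : _ <= (#|letters (2 ^ L.+1) E| +
   (occupied N El + occupied N Er)) * (c ^ s.+1 + 2 * c ^ s)) _; last first.
  by rewrite leq_mul2l cS orbT.
move: le1 le2 le3 le4; rewrite -/c -/N; set f := c ^ s.+1; set g := c ^ s.
move: lets1 lets2 lets3 lets4 letsE pos1 pos2 pos3 pos4.
move: (#|letters N E1|) (#|letters N E2|) (#|letters N E3|) (#|letters N E4|).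
move: (#|A :\: B|) (#|B :\: A|) (#|A :&: B|) (#|letters _ E|).
move: (occupied N E1) (occupied N E2) (occupied N E3) (occupied N E4).
move: (occupied N El) (occupied N Er).
move=> l r p1 p2 p3 p4 a b ab t n1 n2 n3 n4 ? ? ? ? ? ? ? ? ? o1 o2 o3 o4.
apply: leq_trans (leq_add (leq_add o1 o2) (leq_add o3 o4)) _.
rewrite mulnDr -!mulnDl mulnA; apply: leq_add; rewrite leq_mul2r;
  apply/orP; right; lia.
Qed.

End Alternation.

(** * Hitting sets *)

Section Counting.
Local Open Scope nat_scope.

Lemma card_pairs (I J : finType) (P : I -> J -> bool) :
  #|[set x : I * J | P x.1 x.2]| = \sum_i #|[set j | P i j]|.
Proof.
rewrite -sum1_card (eq_bigl (fun x => true && P x.1 x.2)); last first.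
  by move=> x; rewrite inE.
rewrite -(pair_big_dep xpredT P (fun _ _ => 1)) /=.
apply: eq_bigr => i _; rewrite -sum1_card; apply: eq_bigl => j.
by rewrite inE.
Qed.

Lemma occurrencesE (T : finType) N (E : nat -> T -> bool) :
  occurrences N E = #|[set x : 'I_N * T | E x.1 x.2]|.
Proof. by rewrite /occurrences big_mkord (card_pairs (fun i : 'I_N => E i)). Qed.

Lemma occupiedE (T : finType) N (E : nat -> T -> bool) :
  occupied N E = #|[set i : 'I_N | [exists x, E i x]]|.
Proof.
rewrite /occupied big_mkord -sum1_card [RHS]big_mkcond /=.
by apply: eq_bigr => i _; rewrite inE; case: [exists _, _].
Qed.

(** Bernoulli: [(x + t) ^ q] is at least [x ^ q + q * t * x ^ q.-1], and [x <= q * t] makes the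
    second term at least [x ^ q]. *)
Lemma double_expn_le x t q : 0 < q -> x <= q * t -> 2 * x ^ q <= (x + t) ^ q.
Proof.
have bern : forall p, x ^ p.+1 + p.+1 * t * x ^ p <= (x + t) ^ p.+1.
  elim=> [|p IHp]; first by rewrite !expn1 expn0; lia.
  rewrite [(x + t) ^ _]expnS; apply: leq_trans (leq_mul (leqnn (x + t)) IHp).
  rewrite ![x ^ _.+1]expnS; move: (x ^ p) => y; nia.
case: q => // q _ xq.
apply: leq_trans (bern q); rewrite mul2n -addnn leq_add2l expnS.
by rewrite leq_mul2r xq orbT.
Qed.

Section Hitting.
Variables (I V : finType) (S : I -> {set V}) (t : nat).
Hypothesis t_gt0 : 0 < t.

Definition unhit (R : {set V}) : {set I} :=
  [set i | (t <= #|S i|) && [disjoint S i & R]].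

(** Averaging over [v]: a set still unhit has at least [t] elements, so at most [#|V| - t] choices
    of [v] leave it unhit. *)
Lemma unhit_step (v0 : V) (R : {set V}) : exists v,
  #|unhit (v |: R)| * #|V| <= #|unhit R| * (#|V| - t).
Proof.
have unhitE v : unhit (v |: R) = [set i | (i \in unhit R) && (v \notin S i)].
  apply/setP => i; rewrite !inE -andbA; congr (_ && _).
  by rewrite disjoint_sym disjoints_subset subUset sub1set inE -disjoints_subset
    andbC disjoint_sym.
have tot : \sum_v #|unhit (v |: R)| <= #|unhit R| * (#|V| - t).
  rewrite (eq_bigr (fun v => \sum_(i in unhit R) (v \notin S i : nat))); last first.
    move=> v _; rewrite unhitE -sum1dep_card big_mkcondr /=.
    by apply: eq_bigr => i _; case: (v \in S i).
  rewrite exchange_big /= -sum_nat_const; apply: leq_sum => i.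
  rewrite inE => /andP[ti _].
  rewrite -[X in X <= _](_ : #|~: S i| = _).
    by rewrite cardsCs setCK leq_sub2l.
  rewrite -sum1_card big_mkcond /=; apply: eq_bigr => v _.
  by rewrite inE; case: (v \in S i).
case: (pickP [pred v | #|unhit (v |: R)| * #|V| <= #|unhit R| * (#|V| - t)]).
  by move=> v /= ?; exists v.
move=> no; exfalso.
have : \sum_(v : V) (#|unhit R| * (#|V| - t)).+1 <= \sum_v #|unhit (v |: R)| * #|V|.
  by apply: leq_sum => v _; have /= := no v; rewrite leqNgt => /negbFE.
rewrite sum_nat_const -big_distrl /= [X in _ <= X]mulnC => h.
have n0 : 0 < #|V| by apply/card_gt0P; exists v0.
by move: h; rewrite leq_pmul2l // => /leq_trans/(_ tot); rewrite ltnn.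
Qed.

Lemma unhit_iter (v0 : V) r : exists2 R : {set V}, #|R| <= r &
  #|unhit R| * #|V| ^ r <= #|I| * (#|V| - t) ^ r.
Proof.
elim: r => [|r [R Rr IH]].
  by exists set0; rewrite ?cards0 // !expn0 !muln1 max_card.
have [v vP] := unhit_step v0 R; exists (v |: R).
  by rewrite cardsU1 -add1n leq_add // leq_b1.
rewrite !expnS mulnA; apply: leq_trans (leq_mul vP (leqnn _)) _.
by rewrite mulnAC mulnC [X in _ <= X]mulnCA leq_mul2l IH orbT.
Qed.

(* Each block of #|V| / t + 1 greedy choices halves the number of sets missed. *)
Lemma hitting_set (v0 : V) s : #|I| < 2 ^ s ->
  exists2 R : {set V}, #|R| <= s * (#|V| %/ t).+1 &
    forall i, t <= #|S i| -> ~~ [disjoint S i & R].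
Proof.
move=> Is; set q := (#|V| %/ t).+1.
have [R Rr RP] := unhit_iter v0 (s * q); exists R => // i ti.
apply/negP => dis.
have n0 : 0 < #|V| by apply/card_gt0P; exists v0.
have tV : t <= #|V| := leq_trans ti (max_card _).
have h2 : 2 * (#|V| - t) ^ q <= #|V| ^ q.
  rewrite -{2}(subnK tV); apply: double_expn_le => //.
  by apply: leq_trans (leq_subr _ _) (ltnW (ltn_ceil _ t_gt0)).
have h2s : 2 ^ s * (#|V| - t) ^ (s * q) <= #|V| ^ (s * q).
  by rewrite [s * q]mulnC !expnM -expnMn; case: (s) => // s'; rewrite leq_exp2r.
have U0 : 0 < #|unhit R| by apply/card_gt0P; exists i; rewrite inE ti.
have Vs : 0 < #|V| ^ (s * q) by rewrite expn_gt0 n0.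
have : #|V| ^ (s * q) <= #|I| * (#|V| - t) ^ (s * q).
  by apply: leq_trans RP; rewrite leq_pmull.
move=> h; have : 0 < (#|V| - t) ^ (s * q).
  by case: ((#|V| - t) ^ (s * q)) h => //; rewrite muln0 leqNgt Vs.
move=> x0; have := leq_trans h2s h.
by rewrite leq_pmul2r // leqNgt Is.
Qed.

End Hitting.
End Counting.

(** * Incidences on an envelope *)

Section ChartDef.
Variables (R : realDomainType) (V : finType).
Local Open Scope ring_scope.

(* [F rho] is compared with the other [F b] along meridians: on the meridian
   [s], the condition [F b c <= F rho c] confines the height [p c] to an interval
   with right end [K false b s] and left end [- K true b s]. The bound 18 on the
   alternations is 2 * (8 + 1), where 8 is the degree of the polynomial vanishing
   between two consecutive changes of order of two such ends. *)
Definition envelope_chart (F : V -> V -> R) (rho : V) (sg p : V -> R)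
    (K : bool -> V -> R -> R) : Prop :=
  [/\ forall b c, b != rho -> c != rho ->
        F b c <= F rho c <-> forall e : bool, (-1) ^+ e * p c <= K e b (sg c),
      forall b c, b != rho -> c != rho -> F b c = F rho c ->
        exists e : bool, (-1) ^+ e * p c = K e b (sg c),
      forall (e : bool) a b (c : nat -> V), a != b -> a != rho -> b != rho ->
        (forall i, (i < 18)%N -> c i != rho) ->
        (forall i, (i.+1 < 18)%N -> sg (c i) < sg (c i.+1)) ->
        ~ (forall i, (i < 18)%N -> if odd i
             then K e b (sg (c i)) <= K e a (sg (c i))
             else K e a (sg (c i)) <= K e b (sg (c i))) &
      forall c c', c != rho -> c' != rho -> sg c = sg c' -> p c = p c' -> c = c'].

End ChartDef.

Section Incidences.
Variables (R : realDomainType) (V : finType) (F : V -> V -> R) (M : R).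
Variables (sg p : V -> V -> R) (K : V -> bool -> V -> R -> R) (L : nat).
Hypothesis F_sym : forall b c, F b c = F c b.
Hypothesis F_le : forall b c, (F b c <= M)%R.
Hypothesis F_diag : forall b, (F b b < M)%R.
Hypothesis chart : forall rho, envelope_chart F rho (sg rho) (p rho) (K rho).
Hypothesis VL : #|V| <= 2 ^ L.

(** The polylogarithmic loss of the word estimate, instantiated by [(1 + 2 * L) ^ 16]. *)
Variable P : nat.
Hypothesis P_gt0 : 0 < P.
Hypothesis P_occurrences : forall E : nat -> V -> bool,
  (forall i x, E i x -> i < 2 ^ L) ->
  (forall a b, a != b -> ~ alternates E 18 0 a b) ->
  occurrences (2 ^ L) E <= (#|letters (2 ^ L) E| + occupied (2 ^ L) E) * P.

(** * Words along an axis and the weak incidence bound *)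

Definition adj b c := F b c == M.
(** The rank of the meridian of [c], equal for two points exactly when they share their meridian. It
    turns meridians into positions of a word and makes dyadic blocks of meridians available. *)
Definition pos rho c := #|[set c' | (sg rho c' < sg rho c)%R]|.

Lemma adjC b c : adj b c = adj c b.
Proof. by rewrite /adj F_sym. Qed.

Lemma adj_neq b c : adj b c -> b != c.
Proof. by apply: contraTneq => ->; rewrite /adj lt_eqF. Qed.

Lemma pos_bound rho c : pos rho c < 2 ^ L.
Proof.
apply: leq_trans VL; rewrite -cardsT; apply: proper_card.
by apply/properP; split; [apply: subsetT|exists c; rewrite inE ?ltxx].
Qed.

Lemma pos_mono rho c c' : pos rho c < pos rho c' -> (sg rho c < sg rho c')%R.
Proof.
apply: contraTT; rewrite -leqNgt -leNgt => le; apply/subset_leq_card/subsetP.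
by move=> x; rewrite !inE => /lt_le_trans; apply.
Qed.

Lemma pos_inj rho c c' : pos rho c = pos rho c' -> sg rho c = sg rho c'.
Proof.
move=> pE; apply/eqP/negPn/negP => ne.
wlog lt : c c' pE ne / (sg rho c < sg rho c')%R.
  by case: (ltgtP (sg rho c) (sg rho c')) ne => // lt _ th;
     [apply: (th c c')|apply: (th c' c)]; rewrite ?lt_eqF.
suff : pos rho c < pos rho c' by rewrite pE ltnn.
apply: proper_card; apply/properP; split.
  by apply/subsetP => x; rewrite !inE => /lt_trans; apply.
by exists c; rewrite !inE ?ltxx.
Qed.

(* [E q b] selects letters [b] whose bound is the tightest of [B] somewhere in
   the q-th dyadic block of meridians of length [2 ^ l]. *)
Lemma chart_occurrences rho e l (B : {set V}) (E : nat -> V -> bool) :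
  rho \notin B -> (forall q b, E q b -> b \in B) ->
  (forall q b, E q b -> exists c, [/\ c != rho, pos rho c %/ 2 ^ l = q &
     forall b', b' \in B -> (K rho e b (sg rho c) <= K rho e b' (sg rho c))%R]) ->
  occurrences (2 ^ L) E <= (#|B| + occupied (2 ^ L) E) * P.
Proof.
move=> rhoB EB EP; have neB b : b \in B -> b != rho.
  by move=> bB; apply: contraNneq rhoB => <-.
apply: leq_trans (P_occurrences _ _) _.
- by move=> q b /EP[c [_ <- _]]; apply: leq_ltn_trans (pos_bound rho c); apply: leq_div.
- move=> a b ab /alternates_seq[f fP].
  have aB : a \in B by have [/EB] := fP 0 isT.
  have bB : b \in B by have [/EB] := fP 1 isT.
  pose c i := odflt a [pick c | (c != rho) && (pos rho c %/ 2 ^ l == f i) &&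
    [forall b' in B, (K rho e (if odd i then b else a) (sg rho c)
                      <= K rho e b' (sg rho c))%R]].
  have cP i : i < 18 -> [/\ c i != rho, pos rho (c i) %/ 2 ^ l = f i &
     forall b', b' \in B -> (K rho e (if odd i then b else a) (sg rho (c i))
                      <= K rho e b' (sg rho (c i)))%R].
    move=> i18; rewrite /c.
    case: pickP => [x /andP[/andP[xr /eqP xf] /forall_inP xB] //|].
    have [/EP[x [xr xf xB]] _ _] := fP i i18 => /(_ x).
    by rewrite xr xf eqxx /=; move/negP; case; apply/forall_inP.
  have [_ _ g3 _] := chart rho.
  apply: (g3 e a b c ab (neB _ aB) (neB _ bB)) => i i18.
  - by have [] := cP i i18.
  (* Increasing block indices force increasing ranks, hence strictly increasing meridians. *)
  - apply: pos_mono; have [_ h1 _] := cP i (ltnW i18); have [_ h2 _] := cP _ i18.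
    have [_ _ /(_ i18)] := fP i (ltnW i18); rewrite -h1 -h2 !ltnNge.
    by apply: contraNN => /leq_div2r; apply.
  - by have [_ _ h] := cP i i18; move: h; case: (odd i) => h; apply: h.
rewrite leq_mul2r leq_add2r; apply/orP; right; apply/subset_leq_card/subsetP.
by move=> b /lettersP[i _ /EB].
Qed.

(** A point [c] adjacent to [rho] satisfies the constraints of all [b], so a [b] touching it attains
    the tightest bound on its meridian: [c] lies on the upper or the lower envelope. Each side is a
    word with at most one touched point per meridian; the factor 2 counts the sides. *)
Lemma touching_le rho (B C : {set V}) : (forall c, c \in C -> adj rho c) ->
  \sum_(c in C) #|[set b in B | (b != rho) && adj b c]| <= 2 * (#|B| + #|C|) * P.
Proof.
move=> CN; have [g1 g2 g3 g4] := chart rho.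
have Crho c : c \in C -> c != rho by move/CN/adj_neq; rewrite eq_sym.
pose touch (e : bool) c := [set b in B | [&& b != rho, adj b c &
  ((-1) ^+ e * p rho c == K rho e b (sg rho c))%R]].
have cover c : c \in C -> #|[set b in B | (b != rho) && adj b c]| <=
    #|touch false c| + #|touch true c|.
  move=> cC; apply: leq_trans (leq_card_setU _ _).
  apply/subset_leq_card/subsetP => b; rewrite !inE => /and3P[bB br bc].
  have [|e /eqP eE] := g2 b c br (Crho c cC).
    by rewrite (eqP bc) (eqP (CN c cC)).
  by rewrite bB br bc /=; case: e eE => ->; rewrite ?orbT.
suff side e : \sum_(c in C) #|touch e c| <= (#|B| + #|C|) * P.
  apply: (@leq_trans (\sum_(c in C) (#|touch false c| + #|touch true c|))).
    exact: leq_sum.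
  by rewrite big_split /= -mulnA mul2n -addnn leq_add.
pose E i b := [exists c in C, (pos rho c == i) && (b \in touch e c)].
have tight c b b' : c \in C -> b \in touch e c -> b' != rho ->
    (K rho e b (sg rho c) <= K rho e b' (sg rho c))%R.
  rewrite inE => cC /and4P[_ _ _ /eqP <-] b'r.
  have [le_le _] := g1 b' c b'r (Crho c cC).
  by apply: le_le; rewrite (eqP (CN c cC)).
have inj c c' b b' : c \in C -> c' \in C -> b \in touch e c -> b' \in touch e c' ->
    pos rho c = pos rho c' -> c = c'.
  move=> cC c'C bc bc' /pos_inj sE; apply: g4; rewrite ?Crho //.
  have := tight _ _ b' cC bc; have := tight _ _ b c'C bc'; rewrite -sE.
  move: bc bc'; rewrite !inE -sE => /and4P[_ br _ /eqP <-] /and4P[_ br' _ /eqP <-].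
  move=> /(_ br) h1 /(_ br') h2.
  have /eqP : ((-1) ^+ e * p rho c)%R == ((-1) ^+ e * p rho c')%R by rewrite eq_le h1 h2.
  by apply: mulfI; rewrite signr_eq0.
have -> : \sum_(c in C) #|touch e c| =
    #|[set x : V * V | (x.1 \in C) && (x.2 \in touch e x.1)]|.
  rewrite (card_pairs (fun c b => (c \in C) && (b \in touch e c))) big_mkcond /=.
  apply: eq_bigr => c _; case: (c \in C) => /=.
    by apply: eq_card => b; rewrite inE.
  by rewrite (_ : [set _ | _] = set0) ?cards0 //; apply/setP => b; rewrite !inE.
pose f (x : V * V) := (Ordinal (pos_bound rho x.1), x.2).
apply: (@leq_trans (occurrences (2 ^ L) E)).
  rewrite occurrencesE -(card_in_imset (f := f)).
    apply/subset_leq_card/subsetP => x /imsetP[[c b]]; rewrite inE /=.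
    move=> /andP[cC bc] ->; rewrite inE /=; apply/exists_inP; exists c => //.
    by rewrite eqxx.
  move=> [c b] [c' b']; rewrite !inE /= => /andP[cC bc] /andP[c'C bc'].
  case=> pE bE; congr (_, _) => //.
  by apply: (inj c c' b b') => //; rewrite inE.
apply: leq_trans (@chart_occurrences rho e 0 (B :\ rho) E _ _ _) _.
- by rewrite !inE eqxx.
- by move=> q b /exists_inP[c cC /andP[_]]; rewrite !inE => /and3P[-> ->].
- move=> q b /exists_inP[c cC /andP[/eqP <- bc]]; exists c; split.
  + exact: Crho.
  + by rewrite expn0 divn1.
  + by move=> b'; rewrite !inE => /andP[b'r _]; apply: tight.
rewrite leq_mul2r leq_add ?orbT ?subset_leq_card ?subsetDl //.
rewrite occupiedE.
apply: leq_trans (leq_imset_card (fun c => Ordinal (pos_bound rho c)) C).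
apply/subset_leq_card/subsetP => i; rewrite inE => /existsP[b /exists_inP[c cC]].
by move=> /andP[/eqP pc _]; apply/imsetP; exists c => //; apply/val_inj.
Qed.

Definition deg_in (C : {set V}) b := #|[set c in C | adj b c]|.
Definition edges (B C : {set V}) := \sum_(c in C) deg_in B c.

Lemma edgesC B C : edges B C = edges C B.
Proof.
have sum X Y : edges X Y = \sum_(c in Y) \sum_(b in X) adj b c.
  apply: eq_bigr => c _; rewrite /deg_in -sum1dep_card big_mkcondr /=.
  by apply: eq_bigr => b _; rewrite adjC; case: (adj _ _).
rewrite !sum exchange_big /=; apply: eq_bigr => b _; apply: eq_bigr => c _.
by rewrite adjC.
Qed.

(** The left side counts pairs of distinct neighbours [c], [c'] in [C] of some [b] in [B]. For fixed
    [c], these are touchings by [c'] of points [b] on the cylinder of [c], so [touching_le] applies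
    with axis [c]. *)
Lemma sum_deg_sq (B C : {set V}) :
  \sum_(b in B) deg_in C b * (deg_in C b).-1 <= 2 * P * (#|C| ^ 2 + edges B C).
Proof.
have -> : \sum_(b in B) deg_in C b * (deg_in C b).-1 =
    \sum_(c in C) \sum_(b in B | adj b c) #|[set c' in C | (c' != c) && adj c' b]|.
  rewrite (exchange_big_dep (mem B)) /=; last by move=> c b _ /andP[].
  apply: eq_bigr => b bB.
  rewrite (eq_bigl (fun c => (c \in C) && adj b c)); last first.
    by move=> c; rewrite bB.
  rewrite (eq_bigr (fun=> (deg_in C b).-1)).
    by rewrite sum_nat_cond_const /deg_in; congr (_ * _).
  move=> c /andP[cC bc]; rewrite /deg_in (cardsD1 c [set c' in C | adj b c']).
  rewrite inE cC bc /=; apply: eq_card => c'; rewrite !inE adjC.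
  by rewrite andbCA.
apply: (@leq_trans (\sum_(c in C) 2 * (#|C| + deg_in B c) * P)).
  apply: leq_sum => c cC.
  rewrite (eq_bigl (fun b => b \in [set b in B | adj c b])); last first.
    by move=> b; rewrite inE adjC.
  by apply: touching_le => b; rewrite inE => /andP[].
rewrite -big_distrl -big_distrr /= big_split /= sum_nat_const mulnn.
by rewrite -/(edges B C) mulnAC.
Qed.

(** Vertices of degree [d] at most a threshold [w] are counted trivially; beyond it
    [w * d <= d * d.-1], and [sum_deg_sq] takes over. *)
Lemma edges_le (B C : {set V}) k : 0 < k -> #|B| <= k ^ 2 ->
  edges B C <= (8 * P + 2) * k ^ 2 + (4 * P + 2) * k * #|C|.
Proof.
(* The summand [4 * P] lets half of [w * edges B C] absorb the edge term of [sum_deg_sq];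
   [(m %/ k).+1] balances [#|B| * w ^ 2] against [m ^ 2]. *)
move=> k0 Bk; set m := #|C|; pose w := 4 * P + (m %/ k).+1.
have mw : m <= w * k.
  apply: leq_trans (ltnW (ltn_ceil m k0)) _.
  by rewrite leq_mul2r leq_addl orbT.
have h1 : w * edges B C <= #|B| * w ^ 2 + 2 * P * (m ^ 2 + edges B C).
  apply: leq_trans (leq_add (leqnn _) (sum_deg_sq B C)).
  rewrite edgesC /edges big_distrr -sum_nat_const -big_split /=.
  apply: leq_sum => b _; set d := deg_in C b.
  case: (leqP d w) => dw.
    by rewrite (leq_trans _ (leq_addr _ _)) // expnS expn1 leq_mul2l dw orbT.
  rewrite (leq_trans _ (leq_addl _ _)) // mulnC leq_mul2l.
  by case: (d) dw => //= d'; rewrite ltnS => ->; rewrite orbT.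
have h2 : w * edges B C <= w * (2 * k ^ 2 * w + 4 * P * m * k).
  have hB : #|B| * w ^ 2 <= k ^ 2 * w ^ 2 by rewrite leq_mul2r Bk orbT.
  have hm : m ^ 2 <= m * (w * k) by rewrite expnS expn1 leq_mul2l mw orbT.
  have hw : 4 * P <= w by apply: leq_addr.
  have hwI := leq_mul hw (leqnn (edges B C)).
  have hPm := leq_mul (leqnn P) hm.
  move: h1 hB hwI hPm; rewrite !expnS !expn0.
  clear; clearbody w m; move: (edges B C) (#|B|) P => I n Q; nia.
have w0 : 0 < w by rewrite /w addnS.
move: h2; rewrite leq_pmul2l // => /leq_trans; apply.
have : (m %/ k) * k <= m by apply: leq_divM.
rewrite /w !expnS !expn0; clear; clearbody m; move: P (m %/ k) => Q j; nia.
Qed.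

(** * Cells of a sample and their conflict sets *)

Definition descriptor : finType :=
  (V * 'I_L.+1 * 'I_(2 ^ L) * {ffun 'I_(4 * P) -> V})%type.

Definition points (d : descriptor) : {set V} :=
  let rho := d.1.1.1 in
  [set c | [&& c != rho, pos rho c %/ 2 ^ d.1.1.2 == d.1.2 :> nat &
               [forall i, (F (d.2 i) c <= F rho c)%R]]].

Definition conflict (d : descriptor) : {set V} :=
  [set b | [exists c in points d, (F d.1.1.1 c < F b c)%R]].

(** An axis, a dyadic block and [4 * P] points determine a conflict set without mention of the
    sample. The logarithm of the number of sets to be hit is thus polylogarithmic, and so is the
    loss in the sample size. *)
Lemma card_descriptor : #|{: descriptor}| < 2 ^ (L * (4 * P + 3)).+1.
Proof.
rewrite /descriptor !card_prod card_ffun !card_ord.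
have L2 : L.+1 <= 2 ^ L by rewrite ltn_expl.
apply: (@leq_ltn_trans (2 ^ (L * (4 * P + 3)))); last by rewrite ltn_exp2l.
move: (4 * P) => w; rewrite mulnDr expnD !expnM mulnC leq_mul //.
  by case: w => // w; rewrite leq_exp2r.
by rewrite !expnS expn0 muln1 mulnA !leq_mul.
Qed.

Section Sample.
Variable S : {set V}.

(** The sampled cylinder carrying side [e] of the envelope on the meridian [s]; a dummy value if [S]
    has no member besides [rho]. *)
Definition letter rho e s : V :=
  Order.arg_min (odflt rho [pick b in S :\ rho]) (mem (S :\ rho))
    (fun b => K rho e b s).

Lemma letterP rho e s b : b \in S :\ rho ->
  letter rho e s \in S :\ rho /\ (K rho e (letter rho e s) s <= K rho e b s)%R.
Proof.
move=> bS; rewrite /letter; case: pickP => [b0 /= b0S|/(_ b)]; last by rewrite bS.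
by case: arg_minP => //= i iS iP; split => //; apply: iP.
Qed.

Definition node rho e l q : {set V} :=
  [set b in S :\ rho | [exists c, [&& c != rho, pos rho c %/ 2 ^ l == q &
                                      letter rho e (sg rho c) == b]]].

Lemma node_sub rho e l q : node rho e l q \subset S.
Proof. by apply/subsetP => b; rewrite !inE => /andP[/andP[]]. Qed.

Lemma node_leaf rho e q : #|node rho e 0 q| <= 1.
Proof.
rewrite leqNgt; apply/negP => /card_gt1P[x [y [xn yn /negP]]]; apply.
move: xn yn; rewrite !inE expn0 => /andP[_ /existsP[c]] /[swap].
move=> /andP[_ /existsP[c']]; rewrite !divn1.
by case/and3P=> _ /eqP <- /eqP <- /and3P[_ /eqP/pos_inj -> /eqP ->].
Qed.

(** In the word restricted to the [d] blocks with more than [2 * P] letters, [chart_occurrences]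
    gives [d * (2 * P + 1) <= (#|S| + d) * P], which forces [d <= #|S|]. *)
Lemma node_bad rho e l :
  #|[set q : 'I_(2 ^ L) | 2 * P < #|node rho e l q|]| <= #|S|.
Proof.
pose E q b := (2 * P < #|node rho e l q|) && (b \in node rho e l q).
have occ : occurrences (2 ^ L) E <= (#|S :\ rho| + occupied (2 ^ L) E) * P.
  apply: (@chart_occurrences rho e l).
  - by rewrite !inE eqxx.
  - by move=> q b /andP[_]; rewrite inE => /andP[].
  - move=> q b /andP[_]; rewrite inE => /andP[bS /existsP[c /and3P[cr /eqP pq /eqP lb]]].
    exists c; split => // b' b'S; rewrite -lb.
    by have [] := letterP e (sg rho c) b'S.
rewrite occupiedE in occ.
have DE : [set i : 'I_(2 ^ L) | [exists x, E i x]] =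
    [set q : 'I_(2 ^ L) | 2 * P < #|node rho e l q|].
  apply/setP => q; rewrite !inE; apply/existsP/idP => [[b /andP[]//]|h].
  have /card_gt0P[b bn] : 0 < #|node rho e l q| by apply: leq_ltn_trans h.
  by exists b; rewrite /E h.
rewrite {}DE in occ; set D := [set q : 'I_(2 ^ L) | _] in occ *.
have : #|D| * (2 * P).+1 <= occurrences (2 ^ L) E.
  rewrite -sum_nat_const /occurrences big_mkord big_mkcond /=.
  apply: leq_sum => q _; rewrite inE; case: ifP => // h.
  apply: leq_trans (h) _; apply/subset_leq_card/subsetP => b bn.
  by rewrite inE /E h.
have sS : #|S :\ rho| <= #|S| by rewrite subset_leq_card ?subsetDl.
move: P_gt0 occ sS; move: (occurrences _ _) (#|S :\ rho|) (#|D|) (#|S|) P.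
by move=> o s' d s Q; nia.
Qed.

Definition good rho l q := [forall e, #|node rho e l q| <= 2 * P].

Lemma good0 rho q : good rho 0 q.
Proof.
apply/forallP => e; apply: leq_trans (node_leaf rho e q) _.
by rewrite muln_gt0 P_gt0.
Qed.

Lemma card_bad rho l : #|[set q : 'I_(2 ^ L) | ~~ good rho l q]| <= 2 * #|S|.
Proof.
rewrite mul2n -addnn.
apply: leq_trans (leq_add (node_bad rho false l) (node_bad rho true l)).
apply: leq_trans (leq_card_setU _ _); apply/subset_leq_card/subsetP => q.
by rewrite !inE negb_forall => /existsP[[]]; rewrite -ltnNge => ->; rewrite ?orbT.
Qed.

(** Each bad block has two halves, which doubles [card_bad]. Maximal good blocks below the top level
    are among these halves. *)
Lemma card_bad_children rho l :
  #|[set q : 'I_(2 ^ L) | ~~ good rho l (q %/ 2)]| <= 4 * #|S|.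
Proof.
have half_lt (q : 'I_(2 ^ L)) : q %/ 2 < 2 ^ L by rewrite (leq_ltn_trans (leq_div _ _)).
pose f (q : 'I_(2 ^ L)) := (Ordinal (half_lt q), odd q).
have f_inj : injective f.
  move=> q q' [h1 h2]; apply/val_inj; rewrite /= (divn_eq q 2) (divn_eq q' 2) h1.
  by rewrite !modn2 h2.
rewrite -(card_imset _ f_inj).
apply: (@leq_trans #|setX [set q : 'I_(2 ^ L) | ~~ good rho l q] [set: bool]|).
  apply/subset_leq_card/subsetP => _ /imsetP[q + ->].
  by rewrite !inE andbT.
by rewrite cardsX cardsT card_bool; have := card_bad rho l; lia.
Qed.

Definition far : {set V} := [set c | (c \notin S) && [forall b in S, ~~ adj b c]].

(** A point of [S] has degree at most [#|V|]. At the neighbours of one [b] in [S], the edges to [b]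
    count once each, and [touching_le] with axis [b] bounds all the others. *)
Lemma edges_near : \sum_(c in ~: far) deg_in setT c <=
  #|S| * #|V| * (4 * P + 2).
Proof.
have degV c : deg_in setT c <= #|V| by apply: max_card.
apply: (@leq_trans (\sum_(c in S) #|V| +
    \sum_(b in S) \sum_(c | adj b c) deg_in setT c)).
  apply: (@leq_trans (\sum_(c in ~: far) ((c \in S) * #|V| +
      \sum_(b in S) adj b c * deg_in setT c))).
    apply: leq_sum => c; rewrite !inE negb_and negbK => /orP[->|].
      by rewrite mul1n (leq_trans (degV c)) ?leq_addr.
    rewrite negb_forall_in => /exists_inP[b bS]; rewrite negbK => bc.
    rewrite (leq_trans _ (leq_addl _ _)) // (bigD1 b) //= bc mul1n.
    exact: leq_addr.
  rewrite big_split /= leq_add //.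
    rewrite big_mkcond [X in _ <= X]big_mkcond /=; apply: leq_sum => c _.
    by case: (c \in ~: _); case: (c \in S); rewrite ?mul1n ?mul0n.
  rewrite exchange_big /=; apply: leq_sum => b bS.
  rewrite big_mkcond [X in _ <= X]big_mkcond /=; apply: leq_sum => c _.
  by case: (c \in ~: _); case: (adj b c); rewrite ?mul1n ?mul0n.
rewrite sum_nat_const -mulnA; apply: (@leq_trans
  (#|S| * #|V| + \sum_(b in S) (#|V| * (4 * P + 1)))); last first.
  by rewrite sum_nat_const -mulnDr leq_mul2l; apply/orP; right; lia.
rewrite leq_add2l; apply: leq_sum => b bS.
set N := [set c | adj b c].
have -> : \sum_(c | adj b c) deg_in setT c = \sum_(c in N) deg_in setT c.
  by apply: eq_bigl => c; rewrite inE.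
apply: (@leq_trans (\sum_(c in N)
    (1 + #|[set b' in setT | (b' != b) && adj b' c]|))).
  apply: leq_sum => c _.
  rewrite /deg_in (cardsD1 b) leq_add ?leq_b1 // subset_leq_card //.
  by apply/subsetP => b'; rewrite !inE /= => /andP[->]; rewrite adjC.
have NV : #|N| <= #|V| by apply: max_card.
have := @touching_le b setT N; rewrite cardsT big_split /= sum1_card => h.
have /h {}h : forall c, c \in N -> adj b c by move=> c; rewrite inE.
rewrite mulnDr muln1 addnC leq_add //; apply: leq_trans h _.
rewrite mulnA leq_mul2r; apply/orP; right.
by rewrite mulnC -[4]/(2 * 2) mulnA leq_mul2r muln2 -addnn leq_add2l NV.
Qed.

Variable b0 : V.
Hypothesis b0S : b0 \in S.

(** The face where the ray through [c] leaves the intersection of the sampled cylinders: the first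
    one left is the one with [F b c] largest. *)
Definition top c : V := Order.arg_max b0 (mem S) (fun b => F b c).

Lemma topP c : top c \in S /\ forall b, b \in S -> (F b c <= F (top c) c)%R.
Proof.
by rewrite /top; case: arg_maxP => //= i iS iP; split => // b bS; apply: iP.
Qed.

Definition level c : 'I_L.+1 :=
  arg_max ord0 (fun l : 'I_L.+1 => good (top c) l (pos (top c) c %/ 2 ^ l))
    (@nat_of_ord _).

Lemma levelP c : good (top c) (level c) (pos (top c) c %/ 2 ^ level c) /\
  forall l : 'I_L.+1, good (top c) l (pos (top c) c %/ 2 ^ l) -> l <= level c.
Proof.
by rewrite /level; case: arg_maxnP => [|l gl lP]; [apply: good0|split].
Qed.

Lemma block_lt rho c l : pos rho c %/ 2 ^ l < 2 ^ L.
Proof. by apply: leq_ltn_trans (leq_div _ _) (pos_bound rho c). Qed.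

Definition cell c : V * 'I_L.+1 * 'I_(2 ^ L) :=
  (top c, level c, Ordinal (block_lt (top c) c (level c))).

(** The constraints are the pieces of both envelopes over the block, at most [4 * P] when the block
    is good. Spare slots hold the axis, whose constraint is void. *)
Definition cell_descriptor (x : V * 'I_L.+1 * 'I_(2 ^ L)) : descriptor :=
  (x, [ffun i : 'I_(4 * P) =>
         nth x.1.1 (enum (node x.1.1 false x.1.2 x.2 :|: node x.1.1 true x.1.2 x.2)) i]).

(** For an axis in [S], a maximal good block is the single one at level [L], or it has a bad parent;
    [card_bad_children] allows [4 * #|S|] of these on each of the [L] lower levels. *)
Lemma card_cells (C : {set V}) : #|cell @: C| <= #|S| * (1 + 4 * L * #|S|).
Proof.
pose Q rho (l : 'I_L.+1) : {set 'I_(2 ^ L)} :=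
  if l == L :> nat then [set q : 'I_(2 ^ L) | q == 0 :> nat]
  else [set q : 'I_(2 ^ L) | ~~ good rho l.+1 (q %/ 2)].
pose X := [set x : V * ('I_L.+1 * 'I_(2 ^ L)) |
  (x.1 \in S) && (x.2.2 \in Q x.1 x.2.1)].
pose f (x : V * 'I_L.+1 * 'I_(2 ^ L)) := (x.1.1, (x.1.2, x.2)).
have f_inj : injective f by move=> [[a b] c] [[a' b'] c'] [-> -> ->].
rewrite -(card_imset _ f_inj); apply: (@leq_trans #|X|).
  apply/subset_leq_card/subsetP => y /imsetP[x /imsetP[c _ ->] ->].
  rewrite inE /=; have [-> _] := topP c; rewrite /Q /=; case: ifPn => [/eqP lL|lL].
    rewrite inE /= lL divn_small //; exact: pos_bound.
  have [_ lP] := levelP c.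
  have lL' : (level c).+1 < L.+1.
    by rewrite ltnS ltn_neqAle lL /= -ltnS ltn_ord.
  rewrite inE /=; apply/negP => g.
  have := lP (Ordinal lL'); rewrite /= expnSr divnMA => /(_ g); by rewrite ltnn.
rewrite /X (card_pairs (fun a y => (a \in S) && (y.2 \in Q a y.1))) -sum_nat_const.
rewrite [X in _ <= X]big_mkcond /=; apply: leq_sum => rho _.
case: (rho \in S) => /=; last first.
  by rewrite (_ : [set _ | _] = set0) ?cards0 //; apply/setP => y; rewrite !inE.
rewrite (card_pairs (fun l q => q \in Q rho l)) big_ord_recr /= addnC.
apply: leq_add.
  rewrite -[X in _ <= X](cards1 (Ordinal (expn_gt0 2 L))).
  apply/subset_leq_card/subsetP => q; rewrite /Q /= eqxx !inE => /eqP q0.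
  by apply/eqP/val_inj.
rewrite [4 * L]mulnC -mulnA -[X in X * _]card_ord -sum_nat_const.
apply: leq_sum => l _; apply: leq_trans (card_bad_children rho l.+1).
apply/subset_leq_card/subsetP => q; rewrite /Q /=.
by rewrite (ltn_eqF (ltn_ord l)) inE.
Qed.

Variable k : nat.
Hypothesis k_gt0 : 0 < k.
Hypothesis S_hits : forall d, k ^ 2 <= #|conflict d| -> ~~ [disjoint conflict d & S].

(** On every meridian of the block met by a point other than the axis, the tightest sampled bounds
    are among the constraints of the cell, so its points obey all of [S]. Hence [S] misses the
    conflict set, and [S_hits] allows this only for small sets. *)
Lemma cell_conflict c : c \notin S ->
  #|conflict (cell_descriptor (cell c))| <= k ^ 2.
Proof.
move=> cS; rewrite leqNgt; apply/negP => /ltnW/S_hits/negP; apply.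
set rho := top c; set l := level c.
have [gl _] := levelP c; rewrite -/rho -/l in gl.
set q := pos rho c %/ 2 ^ l in gl.
set X := node rho false l q :|: node rho true l q.
have Xsize : size (enum X) <= 4 * P.
  rewrite -cardE; apply: leq_trans (leq_card_setU _ _) _.
  by rewrite -[4]/(2 + 2) mulnDl leq_add // (forallP gl).
rewrite disjoint_sym disjoints_subset; apply/subsetP => b bS; rewrite inE.
apply/negP; rewrite inE => /exists_inP[c']; rewrite inE /= -/rho -/l -/q -/X.
move=> /and3P[c'r /eqP pq /forallP AP]; apply/negP; rewrite -leNgt.
have [->|br] := eqVneq b rho; first by [].
have bS' : b \in S :\ rho by rewrite !inE br.
have FX x : x \in X -> (F x c' <= F rho c')%R.
  move=> xX; have xi : index x (enum X) < 4 * P.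
    by apply: leq_trans Xsize; rewrite index_mem mem_enum.
  have := AP (Ordinal xi); rewrite ffunE /= -/rho -/l -/q -/X.
  by rewrite nth_index ?mem_enum.
have [g1 _ _ _] := chart rho.
apply/(g1 b c' br c'r) => e; have [lS lb] := letterP e (sg rho c') bS'.
have lr : letter rho e (sg rho c') != rho by move: lS; rewrite !inE => /andP[].
apply: le_trans lb; apply: (proj1 (g1 _ c' lr c'r)); apply: FX.
suff : letter rho e (sg rho c') \in node rho e l q.
  by rewrite /X finset.in_setU; case: (e) => ->; rewrite ?orbT.
by rewrite inE lS; apply/existsP; exists c'; rewrite c'r pq !eqxx.
Qed.

(** The point [c] is itself the witness: it lies in its cell as [top c] is maximal over [S], and
    [F (top c) c < M] since [c] is adjacent to no member of [S]. *)
Lemma adj_conflict b c : c \notin S -> (forall b, b \in S -> ~~ adj b c) -> adj b c ->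
  b \in conflict (cell_descriptor (cell c)).
Proof.
move=> cS nadj bc; have [tS tP] := topP c.
rewrite inE; apply/exists_inP; exists c => /=; last first.
  by rewrite (eqP bc) lt_neqAle F_le andbT; apply: nadj.
have ct : c != top c by apply: contraNneq cS => ->.
rewrite inE /= ct eqxx; apply/forallP => i; rewrite ffunE /=.
set s := enum _; case: (ltnP i (size s)) => is_; last by rewrite nth_default.
apply: tP; have := mem_nth (top c) is_; rewrite {1}/s mem_enum inE.
by case/orP; apply/subsetP/node_sub.
Qed.

Lemma edges_far : edges setT far <=
  #|S| * (1 + 4 * L * #|S|) * ((8 * P + 2) * k ^ 2) + (4 * P + 2) * k * #|V|.
Proof.
rewrite /edges (partition_big_imset cell) /=.
pose fib x := [set c in far | cell c == x].
apply: (@leq_trans (\sum_(x in cell @: far)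
    ((8 * P + 2) * k ^ 2 + (4 * P + 2) * k * #|fib x|))).
  apply: leq_sum => x /imsetP[c0 c0far ->].
  have c0S : c0 \notin S by move: c0far; rewrite inE => /andP[].
  apply: leq_trans (edges_le (fib (cell c0)) k_gt0 (cell_conflict c0S)).
  rewrite /edges; apply: eq_leq; apply: eq_big => [c|c /andP[cfar /eqP cc]].
    by rewrite /fib [RHS]inE.
  move: cfar; rewrite inE => /andP[cS /forall_inP nadj].
  apply: eq_card => b; rewrite [LHS]inE [RHS]inE in_setT /=.
  case: (boolP (adj c b)) => [cb|_]; last by rewrite andbF.
  have bc : adj b c by rewrite adjC.
  by rewrite -cc (adj_conflict cS nadj bc).
rewrite big_split /= sum_nat_const leq_add //; first by rewrite leq_mul2r card_cells orbT.
rewrite -big_distrr /= leq_mul2l; apply/orP; right.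
rewrite (_ : \sum_(x in _) _ = #|far|) ?max_card // -sum1_card.
rewrite [RHS](partition_big_imset cell) /=; apply: eq_bigr => x _.
by rewrite -sum1_card; apply: eq_bigl => c; rewrite /fib [LHS]inE.
Qed.

End Sample.

(** As [#|V| %/ k ^ 2 <= k], at most [3 * s * k] points hit all conflict sets of size at least
    [k ^ 2]. The three summands come from [edges_near], from the number of cells and from the points
    in the cells, with [4 * P + 2 <= 6 * P] and [8 * P + 2 <= 10 * P]. *)
Lemma edges_total k s : 0 < k -> #|V| <= k ^ 3 -> s = (L * (4 * P + 3)).+1 ->
  edges setT setT <= (18 * s * P + 90 * s ^ 2 * (1 + 4 * L) * P + 6 * P) * k ^ 4.
Proof.
move=> k0 Vk sE.
case: (pickP [pred v : V | true]) => [v0 _|noV]; last first.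
  by rewrite /edges big_pred0 // => c; have := noV c.
have k2 : 0 < k ^ 2 by rewrite expn_gt0 k0.
have [S0 S0s S0P] := hitting_set conflict k2 v0 card_descriptor.
pose S := v0 |: S0.
have SP d : k ^ 2 <= #|conflict d| -> ~~ [disjoint conflict d & S].
  move=> /S0P; apply: contraNN; rewrite disjoint_sym => h.
  by rewrite disjoint_sym; apply: disjointWl h; apply: subsetUr.
have s1 : 0 < s by rewrite sE.
have Ss : #|S| <= 3 * s * k.
  have h : #|V| %/ k ^ 2 <= k.
    by apply: leq_trans (leq_div2r _ Vk) _; rewrite expnS mulnK.
  have Sc : #|S| <= 1 + #|S0| by rewrite /S cardsU1 leq_add // leq_b1.
  rewrite -sE in S0s; move: S0s h Sc k0 s1; clear.
  by move: (#|S|) (#|S0|) (_ %/ _) => a b c; nia.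
have v0S : v0 \in S by rewrite /S setU11.
have S1 : 0 < #|S| by apply/card_gt0P; exists v0.
have := edges_far v0S k0 SP; have := edges_near S.
have -> : edges setT setT = edges setT (far S) + \sum_(c in ~: far S) deg_in setT c.
  rewrite /edges (bigID (mem (far S))) /=.
  by congr (_ + _); apply: eq_bigl => c; rewrite !inE.
move: Ss S1 k0 Vk P_gt0 s1; clear.
move: (edges setT _) (\sum_(c in _) _) (#|S|) (#|V|) => I J r n rs r1 k0 nk P1 s1 hJ hI.
rewrite addnC [X in _ <= X]mulnDl [X in _ <= X + _]mulnDl -addnA; apply: leq_add.
  apply: leq_trans hJ _.
  apply: (@leq_trans (3 * s * k * k ^ 3 * (6 * P))).
    by apply: leq_mul; [apply: leq_mul|lia].
  by rewrite !expnS expn0; nia.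
apply: leq_trans hI _; apply: leq_add.
  apply: (@leq_trans ((3 * s * k) ^ 2 * (1 + 4 * L) * (10 * P * k ^ 2))).
    apply: leq_mul; last by rewrite leq_mul2r; apply/orP; right; lia.
    apply: (@leq_trans (r * (r * (1 + 4 * L)))).
      by rewrite leq_mul2l mulnDr muln1 leq_add ?orbT // mulnC.
    by rewrite expnS expn1 -mulnA !leq_mul.
  rewrite expnMn [(3 * s) ^ 2]expnMn !expnS !expn0; apply: eq_leq; lia.
apply: (@leq_trans (6 * P * k * k ^ 3)).
  by apply: leq_mul => //; rewrite leq_mul2r; apply/orP; right; lia.
by rewrite -mulnA -expnS.
Qed.

End Incidences.

Section IncidenceBound.
Variables (R : realDomainType) (V : finType) (F : V -> V -> R) (M : R).
Hypothesis F_sym : forall b c, F b c = F c b.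
Hypothesis F_le : forall b c, (F b c <= M)%R.
Hypothesis F_diag : forall b, (F b b < M)%R.

Lemma polylog_le L P Q s : Q = 1 + 2 * L -> P = Q ^ 16 -> s = (L * (4 * P + 3)).+1 ->
  18 * s * P + 90 * s ^ 2 * (1 + 4 * L) * P + 6 * P <= 2 ^ 14 * Q ^ 51.
Proof.
move=> QE PE sE.
(* Both [s] and [(1 + 4 * L) * P] are of order [x = Q ^ 17], so every summand is at most of order
   [x ^ 3]. The constants 144, 90 * 128 and 6 add up to less than [2 ^ 14]. *)
have Q51 : Q ^ 51 = (Q * P) ^ 3 by rewrite PE -expnS -expnM.
have P0 : 0 < P by rewrite PE expn_gt0 QE.
rewrite {}Q51 {PE}; set x := Q * P.
have Q1 : 0 < Q by rewrite QE.
have Px : P <= x by rewrite leq_pmull.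
have x0 : 0 < x by rewrite muln_gt0 Q1.
have sx : s <= 8 * x by rewrite sE /x QE; nia.
have Lx : (1 + 4 * L) * P <= 2 * x.
  by rewrite /x mulnA leq_mul2r; apply/orP; right; rewrite QE; lia.
have x1 : x <= x ^ 3 by rewrite -[X in X <= _]expn1 leq_pexp2l.
have x2 : x ^ 2 <= x ^ 3 by rewrite leq_pexp2l.
move: Px sx Lx x1 x2; clear; clearbody x; move=> Px sx Lx x1 x2.
have a1 : 18 * s * P <= 144 * x ^ 3.
  apply: leq_trans (leq_mul (leq_mul (leqnn 18) sx) Px) _.
  move: x2; rewrite -mulnn; move: (x ^ 3) => y; lia.
have a2 : 90 * s ^ 2 * (1 + 4 * L) * P <= 90 * (128 * x ^ 3).
  rewrite -2![X in X <= _]mulnA leq_mul2l; apply/orP; right.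
  apply: (@leq_trans ((8 * x) ^ 2 * (2 * x))); first by rewrite leq_mul // leq_exp2r.
  by rewrite expnMn mulnACA -expnSr.
have a3 : 6 * P <= 6 * x ^ 3 by rewrite leq_mul2l (leq_trans Px x1) orbT.
apply: leq_trans (leq_add (leq_add a1 a2) a3) _.
by move: (x ^ 3) => y; clear; lia.
Qed.

Lemma incidences_le L k : 0 < k -> #|V| <= 2 ^ L -> #|V| <= k ^ 3 ->
  (forall rho, exists t : (V -> R) * (V -> R) * (bool -> V -> R -> R),
     envelope_chart F rho t.1.1 t.1.2 t.2) ->
  #|[set x : V * V | F x.1 x.2 == M]| <= 2 ^ 14 * (1 + 2 * L) ^ 51 * k ^ 4.
Proof.
move=> k0 VL Vk charts.
have [t tP] := fin_all_exists charts.
have P0 : 0 < (1 + 2 * L) ^ 16 by rewrite expn_gt0.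
(* The word estimate is used with [s = 16], as charts exclude 16 + 2 = 18 alternations. *)
have h := @edges_total R V F M (fun r => (t r).1.1) (fun r => (t r).1.2)
  (fun r => (t r).2) L F_sym F_le F_diag tP VL _ P0
  (@occurrences_alternating V 16 L) k _ k0 Vk erefl.
apply: leq_trans (leq_trans h _); last first.
  by rewrite leq_mul2r (polylog_le erefl erefl erefl) orbT.
rewrite (card_pairs (fun b c => F b c == M)) /edges.
rewrite [X in _ <= X](eq_bigl xpredT) => [|c]; last by rewrite inE.
by apply: leq_sum => c _; apply/subset_leq_card/subsetP => b; rewrite !inE.
Qed.

End IncidenceBound.

From mathcomp Require Import finmap.
From mathcomp Require Import all_classical all_reals all_analysis.
From mathcomp Require Import ring lra.

Import numFieldNormedType.Exports.

Local Open Scope ring_scope.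

(** * Charts for cylinders *)

Section Conics.
Variable R : realFieldType.
Implicit Types r X Y Z x y z p : R.

(** For [c = (x, y, z)], the squared length of [(0, 0, r)] x [c] minus that of [(X, Y, Z)] x [c] is
    [conic_cst + 2 * conic_lin * z - (X ^+ 2 + Y ^+ 2) * z ^+ 2]. *)
Definition conic_lin X Y Z x y := Z * (X * x + Y * y).
Definition conic_cst r X Y Z x y :=
  (r ^+ 2 - (X ^+ 2 + Y ^+ 2 + Z ^+ 2)) * (x ^+ 2 + y ^+ 2) + (X * x + Y * y) ^+ 2.

Lemma sumsq_eq0 x y : x ^+ 2 + y ^+ 2 = 0 -> x = 0 /\ y = 0.
Proof.
move/eqP; rewrite paddr_eq0 ?sqr_ge0 // !sqrf_eq0 => /andP[/eqP-> /eqP->].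
by [].
Qed.

(** The hypothesis says that these two squared lengths agree on the plane
    [z = (z1 * x + z2 * y) / 2]. This forces [b = (X, Y, Z)] to have length [|r|] and the plane to
    be orthogonal to [(0, 0, r) - e * b] for a sign [e]. *)
Lemma conic_line r X Y Z z1 z2 : X ^+ 2 + Y ^+ 2 != 0 ->
  (forall x y, (X ^+ 2 + Y ^+ 2) * (z1 * x + z2 * y) ^+ 2 -
     4 * conic_lin X Y Z x y * (z1 * x + z2 * y) - 4 * conic_cst r X Y Z x y = 0) ->
  exists2 e : R, e ^+ 2 = 1 &
    [/\ 2 * (e * X) = (r - e * Z) * z1, 2 * (e * Y) = (r - e * Z) * z2 &
        X ^+ 2 + Y ^+ 2 = (r - e * Z) * (r + e * Z)].
Proof.
rewrite /conic_lin /conic_cst => A0 H.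
set A := X ^+ 2 + Y ^+ 2 in A0 H *.
have A_gt0 : 0 < A by rewrite lt_def A0 addr_ge0 ?sqr_ge0.
set t := r ^+ 2 - (A + Z ^+ 2) in H.
have e11 : A * z1 ^+ 2 - 4 * Z * X * z1 - 4 * X ^+ 2 = 4 * t.
  by apply/eqP; rewrite -subr_eq0 -(H 1 0); apply/eqP; rewrite /t; ring.
have e22 : A * z2 ^+ 2 - 4 * Z * Y * z2 - 4 * Y ^+ 2 = 4 * t.
  by apply/eqP; rewrite -subr_eq0 -(H 0 1); apply/eqP; rewrite /t; ring.
have e12 : A * z1 * z2 - 2 * Z * (X * z2 + Y * z1) - 4 * X * Y = 0.
  have h := H 1 1; rewrite !expr1n !mulr1 in h; lra.
have det : (4 * t) ^+ 2 + 4 * (A + Z ^+ 2) * (z1 * Y - z2 * X) ^+ 2 = 0.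
  rewrite expr2 -{1}e11 -e22 -[RHS](expr0n R 2) -e12; ring.
have t0 : t = 0.
  move/eqP: det; rewrite paddr_eq0 ?sqr_ge0 //; last first.
    by rewrite mulr_ge0 ?sqr_ge0 // mulr_ge0 // addr_ge0 ?sqr_ge0 // ltW.
  by rewrite sqrf_eq0 mulf_eq0 pnatr_eq0 => /andP[/eqP].
have AZ : A + Z ^+ 2 != 0 by rewrite gt_eqF // ltr_pwDl ?sqr_ge0.
have par : z1 * Y = z2 * X.
  move: det; rewrite t0 mulr0 expr0n add0r => /eqP.
  rewrite mulf_eq0 sqrf_eq0 subr_eq0 => /orP[|/eqP//].
  by rewrite mulf_eq0 pnatr_eq0 (negPf AZ).
pose l := (z1 * X + z2 * Y) / A.
have lA : A * l = z1 * X + z2 * Y by rewrite /l mulrC divfK.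
have z1E : z1 = l * X.
  apply: (mulfI A0); rewrite mulrA lA.
  by transitivity (z1 * X ^+ 2 + (z2 * X) * Y); [rewrite -par /A|]; ring.
have z2E : z2 = l * Y.
  apply: (mulfI A0); rewrite mulrA lA.
  by transitivity ((z1 * Y) * X + z2 * Y ^+ 2); [rewrite par /A|]; ring.
have AE : A = r ^+ 2 - Z ^+ 2 by move: t0; rewrite /t; lra.
have : A * ((l * (r - Z) - 2) * (l * (r + Z) + 2)) = 0.
  have -> : A * ((l * (r - Z) - 2) * (l * (r + Z) + 2)) =
     A * (l ^+ 2 * (r ^+ 2 - Z ^+ 2) - 4 * Z * l - 4) by ring.
  rewrite -AE.
  have : (A * z1 ^+ 2 - 4 * Z * X * z1 - 4 * X ^+ 2) +
         (A * z2 ^+ 2 - 4 * Z * Y * z2 - 4 * Y ^+ 2) = 0.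
    by rewrite e11 e22 t0 mulr0 addr0.
  rewrite z1E z2E => <-; rewrite /A; ring.
move/eqP; rewrite mulf_eq0 (negPf A0) mulf_eq0 /= subr_eq0 addr_eq0.
case/orP => /eqP lE; [exists 1|exists (-1)]; rewrite ?expr1n ?sqrrN ?expr1n //.
  rewrite !mul1r AE z1E z2E; split; last by ring.
    by rewrite mulrA [_ * l]mulrC lE.
  by rewrite mulrA [_ * l]mulrC lE.
rewrite !mulN1r opprK AE z1E z2E; split; last by ring.
  by rewrite mulrA [_ * l]mulrC lE mulrN mulNr.
by rewrite mulrA [_ * l]mulrC lE mulrN mulNr.
Qed.

(* Eliminating p from the two quadratics
   A p^2 - 2 (lin) p - (cst) = 0 attached to a and b. *)
Definition conic_res r Xa Ya Za Xb Yb Zb x y :=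
  let A := Xa ^+ 2 + Ya ^+ 2 in let A' := Xb ^+ 2 + Yb ^+ 2 in
  let B := conic_lin Xa Ya Za x y in let B' := conic_lin Xb Yb Zb x y in
  let D := conic_cst r Xa Ya Za x y in let D' := conic_cst r Xb Yb Zb x y in
  A * (A' * D - A * D') ^+ 2 -
  4 * B * (A * B' - A' * B) * (A' * D - A * D') - 4 * D * (A * B' - A' * B) ^+ 2.

Lemma conic_res_root r Xa Ya Za Xb Yb Zb x y p :
  (Xa ^+ 2 + Ya ^+ 2) * p ^+ 2 - 2 * conic_lin Xa Ya Za x y * p -
    conic_cst r Xa Ya Za x y = 0 ->
  (Xb ^+ 2 + Yb ^+ 2) * p ^+ 2 - 2 * conic_lin Xb Yb Zb x y * p -
    conic_cst r Xb Yb Zb x y = 0 ->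
  conic_res r Xa Ya Za Xb Yb Zb x y = 0.
Proof.
rewrite /conic_res.
set A := Xa ^+ 2 + _; set A' := Xb ^+ 2 + _.
set B := conic_lin Xa Ya Za x y; set B' := conic_lin Xb Yb Zb x y.
set D := conic_cst r Xa Ya Za x y; set D' := conic_cst r Xb Yb Zb x y => ea eb.
have -> : A' * D - A * D' = 2 * (A * B' - A' * B) * p.
  apply/eqP; rewrite -subr_eq0.
  have -> : A' * D - A * D' - 2 * (A * B' - A' * B) * p =
    A * (A' * p ^+ 2 - 2 * B' * p - D') - A' * (A * p ^+ 2 - 2 * B * p - D) by ring.
  by rewrite ea eb !mulr0 subr0.
transitivity (4 * (A * B' - A' * B) ^+ 2 * (A * p ^+ 2 - 2 * B * p - D)); first ring.
by rewrite ea mulr0.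
Qed.

(** If the resultant vanishes identically, either the two quadratics are proportional or the conics
    share a line. In the latter case, by [conic_line], both vectors are up to sign the reflection of
    the axis in one and the same plane. *)
Lemma conic_res_neq0 r Xa Ya Za Xb Yb Zb :
  Xa ^+ 2 + Ya ^+ 2 != 0 -> Xb ^+ 2 + Yb ^+ 2 != 0 ->
  (forall x y, conic_res r Xa Ya Za Xb Yb Zb x y = 0) ->
  [/\ Xa * Yb = Ya * Xb, Xa * Zb = Za * Xb & Ya * Zb = Za * Yb].
Proof.
move=> A0 A'0 H.
pose A := Xa ^+ 2 + Ya ^+ 2; pose A' := Xb ^+ 2 + Yb ^+ 2.
pose ta := r ^+ 2 - (A + Za ^+ 2); pose tb := r ^+ 2 - (A' + Zb ^+ 2).
pose k1 := A * Zb * Xb - A' * Za * Xa; pose k2 := A * Zb * Yb - A' * Za * Ya.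
pose y0 := A' * ta - A * tb + A' * Xa ^+ 2 - A * Xb ^+ 2.
pose y1 := 2 * (A' * Xa * Ya - A * Xb * Yb).
pose y2 := A' * ta - A * tb + A' * Ya ^+ 2 - A * Yb ^+ 2.
pose Xf x y := k1 * x + k2 * y; pose Yf x y := y0 * x ^+ 2 + y1 * x * y + y2 * y ^+ 2.
have HX x y : A * conic_lin Xb Yb Zb x y - A' * conic_lin Xa Ya Za x y = Xf x y.
  by rewrite /conic_lin /Xf /k1 /k2; ring.
have HY x y : A' * conic_cst r Xa Ya Za x y - A * conic_cst r Xb Yb Zb x y = Yf x y.
  by rewrite /conic_cst /Yf /y0 /y1 /y2 /ta /tb /A /A'; ring.
have Hres x y : A * Yf x y ^+ 2 - 4 * conic_lin Xa Ya Za x y * Xf x y * Yf x y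
    - 4 * conic_cst r Xa Ya Za x y * Xf x y ^+ 2 = 0.
  by have := H x y; rewrite /conic_res -/A -/A' HX HY.
have [n0|n0] := eqVneq (k1 ^+ 2 + k2 ^+ 2) 0.
  have [k10 k20] := sumsq_eq0 n0.
  have Y0 x y : Yf x y = 0.
    have := Hres x y; rewrite /Xf k10 k20 !mul0r addr0 expr0n !mulr0 mul0r !subr0.
    by move/eqP; rewrite mulf_eq0 (negPf A0) sqrf_eq0 => /eqP.
  have y00 : y0 = 0 by rewrite -(Y0 1 0) /Yf; ring.
  have y20 : y2 = 0 by rewrite -(Y0 0 1) /Yf; ring.
  have y10 : y1 = 0 by have := Y0 1 1; rewrite /Yf y00 y20; lra.
  have tau : A' * ta - A * tb = 0.
    have : y0 + y2 = 0 by rewrite y00 y20 addr0.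
    by rewrite /y0 /y2 /A /A'; lra.
  have hx : A' * Xa ^+ 2 = A * Xb ^+ 2 by move: y00; rewrite /y0 tau; lra.
  have hy : A' * Ya ^+ 2 = A * Yb ^+ 2 by move: y20; rewrite /y2 tau; lra.
  have hxy : A' * (Xa * Ya) = A * (Xb * Yb) by move: y10; rewrite /y1; lra.
  have par : Xa * Yb = Ya * Xb.
    apply/eqP; rewrite -subr_eq0 -sqrf_eq0; apply/eqP/(mulfI A'0); rewrite mulr0.
    rewrite -/A'.
    have -> : A' * (Xa * Yb - Ya * Xb) ^+ 2 = (A' * Xa ^+ 2) * Yb ^+ 2
       - 2 * (A' * (Xa * Ya)) * (Xb * Yb) + (A' * Ya ^+ 2) * Xb ^+ 2 by ring.
    by rewrite hx hy hxy; ring.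
  have hz : A * A' * Zb = A' * Za * (Xa * Xb + Ya * Yb).
    apply/eqP; rewrite -subr_eq0; apply/eqP.
    transitivity (k1 * Xb + k2 * Yb); last by rewrite k10 k20 !mul0r addr0.
    by rewrite /k1 /k2 /A'; ring.
  have hz' : A * Zb = Za * (Xa * Xb + Ya * Yb).
    by apply: (mulfI A'0); rewrite -/A' mulrCA mulrA hz; ring.
  split => //; apply: (mulfI A0); rewrite -/A mulrCA ?[A * (Xa * _)]mulrCA.
    rewrite hz'; transitivity (Za * (Xa ^+ 2 * Xb + Ya * (Xa * Yb))); first ring.
    by rewrite par /A; ring.
  rewrite hz'; transitivity (Za * (Xa * (Ya * Xb) + Ya ^+ 2 * Yb)); first ring.
  by rewrite -par /A; ring.
set n := k1 ^+ 2 + k2 ^+ 2 in n0.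
(* [Yf] vanishes where the linear form [Xf] does, so [Xf] divides it. The quotient has coefficients
   [z1], [z2], and its half is the common root of the two quadratics. *)
have Yperp : y0 * k2 ^+ 2 - y1 * k1 * k2 + y2 * k1 ^+ 2 = 0.
  have := Hres (- k2) k1.
  have -> : Xf (- k2) k1 = 0 by rewrite /Xf; ring.
  rewrite !mulr0 mul0r expr0n !mulr0 !subr0 => /eqP.
  rewrite mulf_eq0 (negPf A0) sqrf_eq0 /= => /eqP.
  by rewrite /Yf => <-; ring.
pose z1 := (k1 * y0 + k2 * y1 - k1 * y2) / n.
pose z2 := (k2 * y2 + k1 * y1 - k2 * y0) / n.
have nz1 : n * z1 = k1 * y0 + k2 * y1 - k1 * y2 by rewrite /z1 mulrC divfK.
have nz2 : n * z2 = k2 * y2 + k1 * y1 - k2 * y0 by rewrite /z2 mulrC divfK.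
pose Zf x y := z1 * x + z2 * y.
have YE x y : Yf x y = Xf x y * Zf x y.
  apply: (mulfI n0).
  have -> : n * (Xf x y * Zf x y) = Xf x y * (n * z1 * x + n * z2 * y).
    by rewrite /Zf; ring.
  rewrite nz1 nz2; apply/eqP; rewrite -subr_eq0; apply/eqP.
  transitivity ((y0 * k2 ^+ 2 - y1 * k1 * k2 + y2 * k1 ^+ 2) * (x ^+ 2 + y ^+ 2)).
    by rewrite /Yf /Xf /n; ring.
  by rewrite Yperp mul0r.
pose ka x y := A * Zf x y ^+ 2 - 4 * conic_lin Xa Ya Za x y * Zf x y
  - 4 * conic_cst r Xa Ya Za x y.
have ka0 x y : Xf x y != 0 -> ka x y = 0.
  move=> X0; apply: (mulfI (expf_neq0 2 X0)); rewrite mulr0 -(Hres x y) YE /ka.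
  ring.
(* A quadratic form is determined by its values at three pairwise independent vectors; at those
   chosen here [Xf] equals [n], so [ka] vanishes there. *)
have kaE x y : n ^+ 2 * ka x y =
   (x * k1 + y * k2) ^+ 2 * ka k1 k2 +
   (y * k1 - x * k2) ^+ 2 *
     ((ka (k1 - k2) (k2 + k1) + ka (k1 + k2) (k2 - k1)) / 2 - ka k1 k2)
   + (x * k1 + y * k2) * (y * k1 - x * k2) *
     ((ka (k1 - k2) (k2 + k1) - ka (k1 + k2) (k2 - k1)) / 2).
  by rewrite /ka /Zf /n /conic_lin /conic_cst; field.
have kaz x y : ka x y = 0.
  apply: (mulfI (expf_neq0 2 n0)); rewrite mulr0 kaE.
  rewrite !ka0; first by ring.
  - have -> : Xf (k1 + k2) (k2 - k1) = n by rewrite /Xf /n; ring.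
    by [].
  - have -> : Xf (k1 - k2) (k2 + k1) = n by rewrite /Xf /n; ring.
    by [].
  - have -> : Xf k1 k2 = n by rewrite /Xf /n; ring.
    by [].
pose kb x y := A' * Zf x y ^+ 2 - 4 * conic_lin Xb Yb Zb x y * Zf x y
  - 4 * conic_cst r Xb Yb Zb x y.
have kbz x y : kb x y = 0.
  apply: (mulfI A0); rewrite mulr0 -/A.
  have -> : A * kb x y = A' * ka x y - 4 * (Xf x y * Zf x y - Yf x y).
    by rewrite -HX -HY /ka /kb; ring.
  by rewrite kaz YE subrr !mulr0 subrr.
have [e e2 [eX eY eA]] := conic_line A0 kaz.
have [e' e'2 [eX' eY' eA']] := conic_line A'0 kbz.
(* The third coordinate of the reflected axis, expressed by [r] and the plane alone. *)
have rz (u X Y : R) : X ^+ 2 + Y ^+ 2 != 0 -> X ^+ 2 + Y ^+ 2 = (r - u) * (r + u) ->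
    2 * X = (r - u) * z1 -> 2 * Y = (r - u) * z2 ->
    u * (4 + (z1 ^+ 2 + z2 ^+ 2)) = r * (z1 ^+ 2 + z2 ^+ 2 - 4).
  move=> n0' nE hX hY.
  have ru : r - u != 0 by apply: contraNneq n0' => ru; rewrite nE ru mul0r.
  have : (r - u) * (4 * (r + u)) = (r - u) * ((r - u) * (z1 ^+ 2 + z2 ^+ 2)).
    rewrite mulrCA -nE.
    transitivity ((2 * X) ^+ 2 + (2 * Y) ^+ 2); first ring.
    by rewrite hX hY; ring.
  by move/(mulfI ru); lra.
have sq (f X : R) : f ^+ 2 = 1 -> (f * X) ^+ 2 = X ^+ 2.
  by move=> f2; rewrite exprMn f2 mul1r.
have ha := rz (e * Za) (e * Xa) (e * Ya).
rewrite (sq _ _ e2) (sq _ _ e2) in ha.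
have hb := rz (e' * Zb) (e' * Xb) (e' * Yb).
rewrite (sq _ _ e'2) (sq _ _ e'2) in hb.
have eZ : e * Za = e' * Zb.
  have z4 : 4 + (z1 ^+ 2 + z2 ^+ 2) != 0.
    by rewrite gt_eqF // ltr_wpDr // addr_ge0 ?sqr_ge0.
  by apply: (mulIf z4); rewrite ha // hb.
have two : (2 : R) != 0 by rewrite pnatr_eq0.
have eXX : e * Xa = e' * Xb by apply: (mulfI two); rewrite eX eX' eZ.
have eYY : e * Ya = e' * Yb by apply: (mulfI two); rewrite eY eY' eZ.
have key (u u' v v' : R) : e * u = e' * u' -> e * v = e' * v' -> u * v' = v * u'.
  move=> hu hv.
  have ee' : e * e' != 0.
    rewrite mulf_neq0 // -sqrf_eq0 ?e2 ?e'2 oner_eq0 //.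
  apply: (mulfI ee').
  transitivity ((e * u) * (e' * v')); first ring.
  by rewrite hu -hv; ring.
by split; apply: key.
Qed.

End Conics.

(** * Discriminants and resultants as polynomials along the meridians *)

Section Discriminant.
Variable R : realType.
Implicit Types r X Y Z x y p : R.

Definition conic_disc r X Y Z x y :=
  conic_lin X Y Z x y ^+ 2 + (X ^+ 2 + Y ^+ 2) * conic_cst r X Y Z x y.

Lemma conic_disc_form r X Y Z : exists d0 d1 d2, forall x y,
  conic_disc r X Y Z x y = d0 * x ^+ 2 + d1 * (x * y) + d2 * y ^+ 2.
Proof.
pose A := X ^+ 2 + Y ^+ 2; pose t := r ^+ 2 - (A + Z ^+ 2).
exists (Z ^+ 2 * X ^+ 2 + A * (t + X ^+ 2)).
exists (2 * Z ^+ 2 * X * Y + 2 * A * X * Y).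
exists (Z ^+ 2 * Y ^+ 2 + A * (t + Y ^+ 2)).
by move=> x y; rewrite /conic_disc /conic_lin /conic_cst /t /A; ring.
Qed.

Lemma conic_res_form r Xa Ya Za Xb Yb Zb : exists g0 g1 g2 g3 g4, forall x y,
  conic_res r Xa Ya Za Xb Yb Zb x y =
  g0 * x ^+ 4 + g1 * (x ^+ 3 * y) + g2 * (x ^+ 2 * y ^+ 2)
  + g3 * (x * y ^+ 3) + g4 * y ^+ 4.
Proof.
pose A := Xa ^+ 2 + Ya ^+ 2; pose A' := Xb ^+ 2 + Yb ^+ 2.
pose ta := r ^+ 2 - (A + Za ^+ 2); pose tb := r ^+ 2 - (A' + Zb ^+ 2).
pose k1 := A * Zb * Xb - A' * Za * Xa; pose k2 := A * Zb * Yb - A' * Za * Ya.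
pose y0 := A' * ta - A * tb + A' * Xa ^+ 2 - A * Xb ^+ 2.
pose y1 := 2 * (A' * Xa * Ya - A * Xb * Yb).
pose y2 := A' * ta - A * tb + A' * Ya ^+ 2 - A * Yb ^+ 2.
pose m0 := Za * Xa * k1; pose m1 := Za * Xa * k2 + Za * Ya * k1.
pose m2 := Za * Ya * k2.
pose q0 := k1 ^+ 2; pose q1 := 2 * k1 * k2; pose q2 := k2 ^+ 2.
pose d0 := ta + Xa ^+ 2; pose d1 := 2 * Xa * Ya; pose d2 := ta + Ya ^+ 2.
exists (A * y0 ^+ 2 - 4 * (m0 * y0) - 4 * (d0 * q0)).
exists (A * (2 * y0 * y1) - 4 * (m0 * y1 + m1 * y0) - 4 * (d0 * q1 + d1 * q0)).
exists (A * (y1 ^+ 2 + 2 * y0 * y2) - 4 * (m0 * y2 + m1 * y1 + m2 * y0)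
        - 4 * (d0 * q2 + d1 * q1 + d2 * q0)).
exists (A * (2 * y1 * y2) - 4 * (m1 * y2 + m2 * y1) - 4 * (d1 * q2 + d2 * q1)).
exists (A * y2 ^+ 2 - 4 * (m2 * y2) - 4 * (d2 * q2)).
move=> x y; rewrite /conic_res -/A -/A'.
have -> : A * conic_lin Xb Yb Zb x y - A' * conic_lin Xa Ya Za x y =
    k1 * x + k2 * y.
  by rewrite /conic_lin /k1 /k2; ring.
have -> : A' * conic_cst r Xa Ya Za x y - A * conic_cst r Xb Yb Zb x y =
    y0 * x ^+ 2 + y1 * x * y + y2 * y ^+ 2.
  by rewrite /conic_cst /y0 /y1 /y2 /ta /tb /A /A'; ring.
have -> : conic_cst r Xa Ya Za x y = d0 * x ^+ 2 + d1 * x * y + d2 * y ^+ 2.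
  by rewrite /conic_cst /d0 /d1 /d2 /ta /A; ring.
rewrite /conic_lin /q0 /q1 /q2 /m0 /m1 /m2.
by clearbody y0 y1 y2 d0 d1 d2 k1 k2; clearbody A; ring.
Qed.

(** In direction [(X, Y)] the form takes the value [(r * (X ^+ 2 + Y ^+ 2)) ^+ 2], so its
    coefficients do not all vanish. *)
Lemma conic_disc_poly r X Y Z : r != 0 -> X ^+ 2 + Y ^+ 2 != 0 ->
  exists q : {poly R}, [/\ q != 0, (size q <= 3)%N &
    forall s, q.[s] = conic_disc r X Y Z 1 s].
Proof.
move=> r0 A0; have [d0 [d1 [d2 dE]]] := conic_disc_form r X Y Z.
exists (Poly [:: d0; d1; d2]); split; last 1 first.
- by move=> s; rewrite horner_Poly dE /=; ring.
- apply: contra_neq A0 => q0.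
  have coef i : [:: d0; d1; d2]`_i = 0 by rewrite -coef_Poly q0 coef0.
  have /= d00 := coef 0%N; have /= d10 := coef 1%N; have /= d20 := coef 2%N.
  have := dE X Y; rewrite d00 d10 d20 !mul0r !addr0.
  rewrite /conic_disc /conic_lin /conic_cst.
  have -> : (Z * (X * X + Y * Y)) ^+ 2 + (X ^+ 2 + Y ^+ 2) *
     ((r ^+ 2 - (X ^+ 2 + Y ^+ 2 + Z ^+ 2)) * (X ^+ 2 + Y ^+ 2) +
      (X * X + Y * Y) ^+ 2) = (r * (X ^+ 2 + Y ^+ 2)) ^+ 2 by ring.
  by move/eqP; rewrite sqrf_eq0 mulf_eq0 (negPf r0) => /eqP.
- exact: size_Poly.
Qed.

Lemma conic_res_poly r Xa Ya Za Xb Yb Zb :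
  Xa ^+ 2 + Ya ^+ 2 != 0 -> Xb ^+ 2 + Yb ^+ 2 != 0 ->
  ~ [/\ Xa * Yb = Ya * Xb, Xa * Zb = Za * Xb & Ya * Zb = Za * Yb] ->
  exists q : {poly R}, [/\ q != 0, (size q <= 5)%N &
    forall s, q.[s] = conic_res r Xa Ya Za Xb Yb Zb 1 s].
Proof.
move=> A0 A'0 npar.
have [g0 [g1 [g2 [g3 [g4 gE]]]]] := conic_res_form r Xa Ya Za Xb Yb Zb.
exists (Poly [:: g0; g1; g2; g3; g4]); split; last 1 first.
- by move=> s; rewrite horner_Poly gE /=; ring.
- apply/eqP => q0; apply: npar; apply: (@conic_res_neq0 _ r) => // x y.
  have coef i : [:: g0; g1; g2; g3; g4]`_i = 0 by rewrite -coef_Poly q0 coef0.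
  have /= h0 := coef 0%N; have /= h1 := coef 1%N; have /= h2 := coef 2%N.
  have /= h3 := coef 3%N; have /= h4 := coef 4%N.
  by rewrite gE h0 h1 h2 h3 h4 !mul0r !addr0.
- exact: size_Poly.
Qed.

(* Rightmost ([e = false]), resp. opposite of the leftmost ([e = true]), root p
   of A p^2 - 2 (lin) p - (cst). *)
Definition conic_root r X Y Z (e : bool) (s : R) :=
  ((-1) ^+ e * conic_lin X Y Z 1 s + Num.sqrt (conic_disc r X Y Z 1 s))
    / (X ^+ 2 + Y ^+ 2).

Lemma conic_root_eq0 r X Y Z (e : bool) s : X ^+ 2 + Y ^+ 2 != 0 ->
  0 <= conic_disc r X Y Z 1 s ->
  (X ^+ 2 + Y ^+ 2) * ((-1) ^+ e * conic_root r X Y Z e s) ^+ 2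
  - 2 * conic_lin X Y Z 1 s * ((-1) ^+ e * conic_root r X Y Z e s)
  - conic_cst r X Y Z 1 s = 0.
Proof.
move=> A0 d0; rewrite exprMn sqrr_sign mul1r /conic_root.
set A := X ^+ 2 + Y ^+ 2 in A0 *; set B := conic_lin _ _ _ _ _.
set D := conic_cst _ _ _ _ _ _.
have q2 : Num.sqrt (conic_disc r X Y Z 1 s) ^+ 2 = B ^+ 2 + A * D.
  by rewrite sqr_sqrtr.
set q := Num.sqrt _ in q2 *.
have e2 : ((-1 : R) ^+ e) ^+ 2 = 1 by rewrite sqrr_sign.
set f := (-1) ^+ e in e2 *.
apply: (mulfI A0); rewrite mulr0.
transitivity ((f * B + q) ^+ 2 - 2 * B * f * (f * B + q) - A * D); first by field.
transitivity (q ^+ 2 - (f ^+ 2) * B ^+ 2 - A * D); first ring.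
by rewrite q2 e2; ring.
Qed.

(** [Num.sqrt] is zero on negative numbers, so continuity persists across meridians missing the
    cylinder, and the intermediate value theorem can run over a whole interval. *)
Lemma conic_root_continuous r X Y Z e : continuous (conic_root r X Y Z e).
Proof.
move=> s; rewrite /conic_root; apply: cvgMl.
have lin : {for s, continuous (fun s => conic_lin X Y Z 1 s)}.
  apply: cvgMr; apply: cvgD; first exact: cvg_cst.
  by apply: cvgMr; exact: cvg_id.
apply: cvgD; first exact: cvgMr.
apply: (@continuous_comp _ _ _ (fun s => conic_disc r X Y Z 1 s) Num.sqrt);
  last exact: sqrt_continuous.
have [q qE] : exists q : {poly R}, forall s, q.[s] = conic_disc r X Y Z 1 s.
  have [d0 [d1 [d2 dE]]] := conic_disc_form r X Y Z.
  by exists (Poly [:: d0; d1; d2]) => x; rewrite horner_Poly dE /=; ring.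
have -> : (fun s => conic_disc r X Y Z 1 s) = horner q.
  by apply/funext => x; rewrite qE.
exact: continuous_horner.
Qed.

Lemma poly_sign_change (q : {poly R}) s1 s2 : s1 <= s2 ->
  (0 <= q.[s1]) != (0 <= q.[s2]) -> exists2 x, s1 <= x <= s2 & root q x.
Proof.
move=> s12; case: (leP 0 q.[s1]) => h1; case: (leP 0 q.[s2]) => h2 // _.
  have [|x] := @poly_ivt _ (- q) s1 s2 s12.
    by rewrite !hornerN oppr_le0 h1 oppr_ge0 ltW.
  by rewrite rootN; exists x.
have [|x] := @poly_ivt _ q s1 s2 s12; first by rewrite h2 ltW.
by exists x.
Qed.

End Discriminant.

Section Chart.
Variables (R : realType) (V : finType).

Definition sqcross (u v : R * R * R) : R :=
  (u.1.2 * v.2 - u.2 * v.1.2) ^+ 2 + (u.2 * v.1.1 - u.1.1 * v.2) ^+ 2 +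
  (u.1.1 * v.1.2 - u.1.2 * v.1.1) ^+ 2.

Lemma sqcross_axis (r : R) (b c : R * R * R) : c.1.1 != 0 ->
  let s := c.1.2 / c.1.1 in let p := c.2 / c.1.1 in
  sqcross (0, 0, r) c - sqcross b c = c.1.1 ^+ 2 *
   (conic_cst r b.1.1 b.1.2 b.2 1 s + 2 * conic_lin b.1.1 b.1.2 b.2 1 s * p
    - (b.1.1 ^+ 2 + b.1.2 ^+ 2) * p ^+ 2).
Proof.
case: b c => [[X Y] Z] [[x y] z] /= x0.
by rewrite /sqcross /conic_cst /conic_lin /=; field.
Qed.

Lemma finite_family_bounded (I : finType) (f : I -> R) :
  exists M, forall i, `|f i| <= M.
Proof.
exists (\sum_i `|f i|) => i; rewrite (bigD1 i) //= lerDl.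
by apply: sumr_ge0.
Qed.

(** The chart is the central projection of [(x, y, z)] to [(y / x, z / x)]. On a meridian each
    constraint is a quadratic inequality in [p], whose solutions form an interval with ends given by
    [conic_root]. *)
Lemma envelope_chart_axis (v : V -> R * R * R) (rho : V) (r : R) : r != 0 ->
  v rho = (0, 0, r) -> (forall c, c != rho -> (v c).1.1 != 0) ->
  (forall b c, b != c -> sqcross (v b) (v c) != 0) ->
  exists sg p K, envelope_chart (fun b c => sqcross (v b) (v c)) rho sg p K.
Proof.
move=> r0 vrho vx npar.
pose X b := (v b).1.1; pose Y b := (v b).1.2; pose Z b := (v b).2.
pose sg c := Y c / X c; pose p c := Z c / X c.
pose A b := X b ^+ 2 + Y b ^+ 2.
pose B b s := conic_lin (X b) (Y b) (Z b) 1 s.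
pose D b s := conic_cst r (X b) (Y b) (Z b) 1 s.
pose disc b s := conic_disc r (X b) (Y b) (Z b) 1 s.
pose root e b s := conic_root r (X b) (Y b) (Z b) e s.
have A_gt0 b : b != rho -> 0 < A b.
  move=> /vx xb; rewrite ltr_pwDl ?sqr_ge0 // lt_def sqr_ge0 andbT.
  by rewrite sqrf_eq0.
have A0 b : b != rho -> A b != 0 by move=> /A_gt0/gt_eqF ->.
have [M1 M1P] := finite_family_bounded p.
have [M2 M2P] := finite_family_bounded
  (fun x : bool * V * V => root x.1.1 x.1.2 (sg x.2)).
(* Where the meridian misses the cylinder of b, a value below all others and
   distinct for distinct b makes the constraint unsatisfiable. *)
pose low (b : V) := - (`|M1| + `|M2| + 1 + (enum_rank b)%:R).
have low1 b c (e : bool) : low b < (-1) ^+ e * p c.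
  have h : `|(-1) ^+ e * p c| <= M1 by rewrite normrM normr_sign mul1r.
  have := ler_norm (- ((-1) ^+ e * p c)); rewrite normrN /low => h'.
  have := ler_norm M1; have := normr_ge0 M2; have := ler0n R (enum_rank b); lra.
have low2 b e b' c : low b < root e b' (sg c).
  have h := M2P (e, b', c); rewrite /= in h.
  have := ler_norm (- (root e b' (sg c))); rewrite normrN /low => h'.
  have := ler_norm M2; have := normr_ge0 M1; have := ler0n R (enum_rank b); lra.
have low_inj : injective low.
  move=> a b; rewrite /low => h.
  have : (enum_rank a)%:R = (enum_rank b)%:R :> R by lra.
  by move/eqP; rewrite eqr_nat => /eqP/val_inj/enum_rank_inj.
pose K e b s := if 0 <= disc b s then root e b s else low b.
have FE b c : c != rho -> sqcross (v rho) (v c) - sqcross (v b) (v c) =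
    X c ^+ 2 * (D b (sg c) + 2 * B b (sg c) * p c - A b * p c ^+ 2).
  by move=> /vx xc; rewrite vrho sqcross_axis.
have quad b c : b != rho -> A b * (D b (sg c) + 2 * B b (sg c) * p c - A b * p c ^+ 2)
   = disc b (sg c) - (A b * p c - B b (sg c)) ^+ 2.
  by move=> _; rewrite /disc /conic_disc -/(A b) -/(B b _) -/(D b _); ring.
have X2 c : c != rho -> 0 < X c ^+ 2.
  by move=> /vx xc; rewrite lt_def sqr_ge0 andbT sqrf_eq0.
exists sg, p, K; split.
- move=> b c br cr.
  have -> : (sqcross (v b) (v c) <= sqcross (v rho) (v c)) =
      ((A b * p c - B b (sg c)) ^+ 2 <= disc b (sg c)).
    rewrite -subr_ge0 FE // pmulr_rge0 ?X2 // -(pmulr_rge0 _ (A_gt0 b br)) quad //.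
    by rewrite subr_ge0.
  rewrite /K; have [d0|dn] := boolP (0 <= disc b (sg c)).
    rewrite -(ler_sqrt _ d0) sqrtr_sqr ler_norml; set q := Num.sqrt _.
    have rE (e : bool) : (-1) ^+ e * p c <= root e b (sg c) <->
        (-1) ^+ e * (A b * p c - B b (sg c)) <= q.
      rewrite /root /conic_root -/(A b) -/(B b _) -/(disc b _) -/q.
      rewrite ler_pdivlMr ?A_gt0 //.
      have -> : ((-1) ^+ e * p c * A b <= (-1) ^+ e * B b (sg c) + q) =
         ((-1) ^+ e * (A b * p c - B b (sg c)) <= q).
        by rewrite -lerBlDl; congr (_ <= _); ring.
      by [].
    split=> [/andP[h1 h2] e|h].
      by apply/rE; case: e; rewrite ?expr1 ?expr0; lra.
    have /rE := h true; have /rE := h false; rewrite expr0 expr1 => h1 h2.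
    by apply/andP; split; lra.
  split=> [h|h]; first by rewrite (le_trans (sqr_ge0 _) h) in dn.
  have := lt_le_trans (low1 b c false) (h false); by rewrite ltxx.
- move=> b c br cr FF.
  have := FE b c cr; rewrite FF subrr => /esym/eqP.
  rewrite mulf_eq0 gt_eqF ?X2 //= => /eqP h0.
  have := quad b c br; rewrite h0 mulr0 => /esym/eqP; rewrite subr_eq0 => /eqP dE.
  have d0 : 0 <= disc b (sg c) by rewrite dE sqr_ge0.
  rewrite /K d0 /root /conic_root -/(A b) -/(B b _) -/(disc b _).
  rewrite dE sqrtr_sqr.
  have [h|h] := leP 0 (A b * p c - B b (sg c)).
    exists false; rewrite expr0 !mul1r ger0_norm //.
    by apply: (mulIf (A0 b br)); rewrite divfK ?A0 //; ring.
  exists true; rewrite expr1 !mulN1r ltr0_norm //.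
  by apply: (mulIf (A0 b br)); rewrite divfK ?A0 //; ring.
- move=> e a b c ab ar br cr sg_lt alt.
  have [qa [qa0 qas qaE]] := conic_disc_poly (Z a) r0 (A0 a ar).
  have [qb [qb0 qbs qbE]] := conic_disc_poly (Z b) r0 (A0 b br).
  have npar' : ~ [/\ X a * Y b = Y a * X b, X a * Z b = Z a * X b &
                     Y a * Z b = Z a * Y b].
    case=> h1 h2 h3; have := npar a b ab; rewrite /sqcross -/(X a) -/(X b).
    rewrite -/(Y a) -/(Y b) -/(Z a) -/(Z b) h1 h3 -h2 !subrr expr0n /= !addr0.
    by rewrite eqxx.
  have [g [g0 gs gE]] := conic_res_poly r (A0 a ar) (A0 b br) npar'.
  (* The order of two ends changes only where a meridian begins or ceases to miss a cylinder, a root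
     of [qa] or [qb], or where the ends cross, a root of [g]. The degree is at most 2 + 2 + 4. *)
  pose q := qa * qb * g.
  have q0 : q != 0 by rewrite !mulf_neq0.
  have qs : (size q <= 9)%N.
    have := size_mul_leq (qa * qb) g; have := size_mul_leq qa qb.
    rewrite /q; move: (size (qa * qb * g)) (size (qa * qb)) => n1 n2; lia.
  have cross s1 s2 c1 c2 : s1 = sg c1 -> s2 = sg c2 -> s1 < s2 ->
      K e a s1 <= K e b s1 -> K e b s2 <= K e a s2 ->
      exists2 x, s1 <= x <= s2 & poly.root q x.
    move=> s1E s2E s12 h1 h2.
    have [/poly_sign_change|] := boolP ((0 <= qa.[s1]) != (0 <= qa.[s2])).
      move=> /(_ (ltW s12)) [x xs rx]; exists x => //.
      by rewrite !rootM rx.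
    rewrite negbK !qaE => /eqP da.
    have [/poly_sign_change|] := boolP ((0 <= qb.[s1]) != (0 <= qb.[s2])).
      move=> /(_ (ltW s12)) [x xs rx]; exists x => //.
      by rewrite !rootM rx orbT.
    rewrite negbK !qbE => /eqP db.
    move: h1 h2; rewrite /K /disc -da -db.
    case: ifPn => da1; case: ifPn => db1 h1 h2; last first.
    - have /low_inj abE : low a = low b by apply/eqP; rewrite eq_le h1 h2.
      by rewrite abE eqxx in ab.
    - have := lt_le_trans (low2 a e b c2) _; rewrite -s2E => /(_ _ h2).
      by rewrite ltxx.
    - have := lt_le_trans (low2 b e a c1) _; rewrite -s1E => /(_ _ h1).
      by rewrite ltxx.
    pose f x := root e a x - root e b x.
    have fcont : continuous f.
      by move=> x; apply: cvgB; apply: conic_root_continuous.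
    have [||x] := @IVT R f s1 s2 0 (ltW s12).
    - exact: continuous_subspaceT.
    - by rewrite ge_min le_max !subr_le0 !subr_ge0 h1 h2 orbT.
    rewrite in_itv /= => /andP[s1x xs2] /eqP; rewrite subr_eq0 => /eqP fx.
    have [dax|dax] := ltP (disc a x) 0.
      have [|y /andP[s1y yx] ry] := @poly_sign_change _ qa s1 x s1x.
        by rewrite !qaE da1 leNgt dax.
      by exists y; rewrite ?s1y ?(le_trans yx) // !rootM ry.
    have [dbx|dbx] := ltP (disc b x) 0.
      have [|y /andP[s1y yx] ry] := @poly_sign_change _ qb s1 x s1x.
        by rewrite !qbE db1 leNgt dbx.
      by exists y; rewrite ?s1y ?(le_trans yx) // !rootM ry orbT.
    exists x; first by rewrite s1x.
    rewrite !rootM; apply/orP; right; rewrite /poly.root gE; apply/eqP.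
    apply: (@conic_res_root _ _ _ _ _ _ _ _ _ _ ((-1) ^+ e * root e a x)).
      exact: conic_root_eq0 (A0 a ar) dax.
    by rewrite fx; exact: conic_root_eq0 (A0 b br) dbx.
  have mono i j : (i < j)%N -> (j < 18)%N -> sg (c i) < sg (c j).
    elim: j => // j IHj; rewrite ltnS leq_eqVlt => /orP[/eqP->|ij] j18.
      exact: sg_lt.
    by apply: lt_trans (IHj ij _) (sg_lt _ j18); apply: ltnW.
  (* The 18 meridians pair off into nine disjoint intervals with a root of [q] in each, one more
     than its degree allows. *)
  have : forall j : 'I_9, exists x,
      [/\ sg (c j.*2) <= x, x <= sg (c j.*2.+1) & poly.root q x].
    move=> j; have j18 : (j.*2.+1 < 18)%N by have := ltn_ord j; lia.
    have [||x /andP[h1 h2] h3] := cross _ _ _ _ erefl erefl (sg_lt _ j18).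
    - by have := alt _ (ltnW j18); rewrite odd_double.
    - by have := alt _ j18; rewrite /= odd_double.
    by exists x.
  case/fin_all_exists => f fP.
  have f_lt (i j : 'I_9) : (i < j)%N -> f i < f j.
    move=> ij; have [_ h1 _] := fP i; have [h2 _ _] := fP j.
    apply: le_lt_trans h1 (lt_le_trans _ h2); apply: mono; have := ltn_ord j; lia.
  have f_inj : injective f.
    move=> i j fij; apply/val_inj; case: (ltngtP i j) => // /f_lt; by rewrite fij ltxx.
  have := @max_poly_roots _ q [seq f i | i : 'I_9] q0.
  rewrite map_inj_uniq // enum_uniq size_map size_enum_ord => h.
  suff /h /(_ isT) h9 : all (poly.root q) [seq f i | i : 'I_9].
    by have := leq_trans h9 qs.
  by apply/allP => _ /mapP[i _ ->]; have [] := fP i.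
- move=> c c' cr c'r sE pE; apply/eqP/negPn/negP => /npar /eqP; apply.
  have x0 := vx c cr; have x0' := vx c' c'r.
  have yE : Y c = sg c * X c by rewrite /sg divfK.
  have zE : Z c = p c * X c by rewrite /p divfK.
  have yE' : Y c' = sg c * X c' by rewrite sE /sg divfK.
  have zE' : Z c' = p c * X c' by rewrite pE /p divfK.
  rewrite /sqcross -/(X c) -/(Y c) -/(Z c) -/(X c') -/(Y c') -/(Z c').
  by rewrite yE zE yE' zE'; ring.
Qed.

End Chart.

(** * Rotating an arbitrary axis to the third coordinate axis *)

Section Frame.
Variable R : realType.
Implicit Types u v w : R * R * R.

Definition dot3 u v : R := u.1.1 * v.1.1 + u.1.2 * v.1.2 + u.2 * v.2.
Definition cross3 u v : R * R * R :=
  (u.1.2 * v.2 - u.2 * v.1.2, u.2 * v.1.1 - u.1.1 * v.2,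
   u.1.1 * v.1.2 - u.1.2 * v.1.1).

Lemma sqcrossE u v : sqcross u v = dot3 u u * dot3 v v - dot3 u v ^+ 2.
Proof. by rewrite /sqcross /dot3; ring. Qed.

Lemma dot3C u v : dot3 u v = dot3 v u.
Proof. by rewrite /dot3; ring. Qed.

Lemma dot3_crossl u v : dot3 u (cross3 u v) = 0.
Proof. by rewrite /dot3 /cross3 /=; ring. Qed.

Lemma dot3_ge0 u : 0 <= dot3 u u.
Proof. by rewrite /dot3 -!expr2 !addr_ge0 ?sqr_ge0. Qed.

Lemma dot3_eq0 u : dot3 u u = 0 -> u = (0, 0, 0).
Proof.
case: u => [[x y] z]; rewrite /dot3 /= -!expr2 => /eqP.
rewrite !paddr_eq0 ?addr_ge0 ?sqr_ge0 // !sqrf_eq0.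
by case/andP => /andP[/eqP-> /eqP->] /eqP->.
Qed.

Lemma orthogonal_exists u : exists2 w, dot3 w u = 0 & dot3 w w != 0.
Proof.
case: u => [[x y] z].
have [x0|x0] := eqVneq x 0.
  by exists (1, 0, 0); rewrite /dot3 /= ?x0 ?mul1r ?mul0r ?addr0 // oner_eq0.
exists (- y, x, 0); first by rewrite /dot3 /=; ring.
apply/eqP => /dot3_eq0 [_ xz]; by rewrite xz eqxx in x0.
Qed.

(** Parseval in the orthogonal basis [f], [cross3 u f], [u], with denominators cleared. *)
Lemma dot3_frame u f x y : dot3 f u = 0 ->
  dot3 u u * dot3 f f * dot3 x y =
  dot3 u u * (dot3 x f * dot3 y f) + dot3 x (cross3 u f) * dot3 y (cross3 u f)
  + dot3 f f * (dot3 x u * dot3 y u).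
Proof.
move=> fu; apply/eqP; rewrite -subr_eq0; apply/eqP.
transitivity (dot3 f u * (dot3 f u * dot3 x y - dot3 x f * dot3 y u
  - dot3 x u * dot3 y f)); last by rewrite fu mul0r.
by rewrite /dot3 /cross3 /=; ring.
Qed.

Lemma sqcross_frame u w c : dot3 w u = 0 ->
  sqcross u c * dot3 w w = dot3 c (cross3 u w) ^+ 2 + dot3 u u * dot3 c w ^+ 2.
Proof.
move=> wu; apply/eqP; rewrite -subr_eq0; apply/eqP.
transitivity (dot3 w u * (dot3 c c * dot3 w u - 2 * dot3 c u * dot3 c w));
  last by rewrite wu mul0r.
by rewrite /sqcross /dot3 /cross3 /=; ring.
Qed.

(** Rotating [v rho] to the third axis leaves one angle free. No other vector is parallel to
    [v rho], so only finitely many angles give one of them a zero first coordinate, and these can be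
    avoided. *)
Lemma envelope_chart_exists (V : finType) (v : V -> R * R * R) (rho : V) :
  (forall b c, b != c -> sqcross (v b) (v c) != 0) ->
  exists sg p K, envelope_chart (fun b c => sqcross (v b) (v c)) rho sg p K.
Proof.
move=> npar.
case: (pickP [pred c | c != rho]) => [c0 /= c0r|none]; last first.
  have no c : c != rho -> False by move=> cr; have /= := none c; rewrite cr.
  exists (fun=> 0), (fun=> 0), (fun _ _ _ => 0); split.
  - by move=> b c /no.
  - by move=> b c /no.
  - by move=> e a b c _ /no.
  - by move=> c c' /no.
set u := v rho.
have u0 : dot3 u u != 0.
  apply/eqP => /dot3_eq0 uE; have := npar _ _ c0r.
  by rewrite -/u uE /sqcross /= !mulr0 !subrr expr0n !addr0 eqxx.
have [w wu w0] := orthogonal_exists u.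
have [M MP] := finite_family_bounded (fun c => dot3 (v c) w / dot3 (v c) (cross3 u w)).
(* As [k] exceeds all the ratios, [dot3 (v c) f] is nonzero; where the denominator vanishes,
   [sqcross_frame] makes the numerator nonzero. *)
pose k := `|M| + 1; pose w2 := cross3 u w.
pose f : R * R * R := (w.1.1 + k * w2.1.1, w.1.2 + k * w2.1.2, w.2 + k * w2.2).
have fE c : dot3 c f = dot3 c w + k * dot3 c w2 by rewrite /dot3 /f /=; ring.
have fu : dot3 f u = 0.
  transitivity (dot3 w u); last by [].
  by rewrite /f /w2 /dot3 /cross3 /=; ring.
have fc c : c != rho -> dot3 (v c) f != 0.
  move=> cr; rewrite fE; have [h2|h2] := eqVneq (dot3 (v c) w2) 0.
    rewrite h2 mulr0 addr0; apply/eqP => h1.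
    have := sqcross_frame (v c) wu; rewrite -/w2 h1 h2 expr0n /= mulr0 addr0.
    by move/eqP; rewrite mulf_eq0 (negPf w0) orbF (negPf (npar _ _ _)) // eq_sym.
  apply/eqP => h; have := MP c; rewrite -/w2.
  have -> : dot3 (v c) w / dot3 (v c) w2 = - k.
    apply: (mulIf h2); rewrite divfK //; lra.
  have nM := ler_norm M; have M0 := normr_ge0 M.
  rewrite normrN ger0_norm /k; last lra.
  by apply/negP; rewrite -ltNge; lra.
have f0 : dot3 f f != 0.
  apply/eqP => /dot3_eq0 f0; have := fc _ c0r.
  by rewrite f0 /dot3 /= !mulr0 !addr0 eqxx.
pose nf := Num.sqrt (dot3 f f); pose nu := Num.sqrt (dot3 u u).
have nf2 : nf ^+ 2 = dot3 f f by rewrite sqr_sqrtr ?dot3_ge0.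
have nu2 : nu ^+ 2 = dot3 u u by rewrite sqr_sqrtr ?dot3_ge0.
have nf0 : nf != 0 by rewrite -sqrf_eq0 nf2.
have nu0 : nu != 0 by rewrite -sqrf_eq0 nu2.
pose Phi c : R * R * R :=
  (dot3 c f / nf, dot3 c (cross3 u f) / (nu * nf), dot3 c u / nu).
have PhiD x y : dot3 (Phi x) (Phi y) = dot3 x y.
  apply: (mulfI u0); apply: (mulfI f0); rewrite [RHS]mulrCA [RHS]mulrA dot3_frame //.
  rewrite [dot3 (Phi x) (Phi y)]/dot3 /Phi /= -nf2 -nu2.
  move: (dot3 x f) (dot3 y f) (dot3 x u) (dot3 y u) => x1 y1 x3 y3.
  move: (dot3 x (cross3 u f)) (dot3 y (cross3 u f)) => x2 y2.
  by clearbody nf nu; field; rewrite nu0.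
have PhiF b c : sqcross (Phi b) (Phi c) = sqcross b c by rewrite !sqcrossE !PhiD.
have [|c cr|b c bc|sg [p [K KP]]] := @envelope_chart_axis R V (Phi \o v) rho nu nu0.
- rewrite /Phi /= -/u; congr (_, _, _).
  + by rewrite dot3C fu mul0r.
  + by rewrite dot3_crossl mul0r.
  + by rewrite -nu2 expr2 mulfK.
- by rewrite /Phi /= mulf_neq0 ?invr_eq0 // fc.
- by rewrite /= PhiF npar.
exists sg, p, K; case: KP => g1 g2 g3 g4; split => //.
- by move=> b c br cr; have := g1 b c br cr; rewrite /= !PhiF.
- by move=> b c br cr; have := g2 b c br cr; rewrite /= !PhiF.
Qed.

End Frame.

(** * Maximum area triangles *)

Section Reduction.
Variable R : realType.
Implicit Types (u v w : R * R * R) (x y : 'rV[R]_3).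

Lemma sqcrossC u v : sqcross u v = sqcross v u.
Proof. by rewrite /sqcross; ring. Qed.

Lemma sqcrossvv u : sqcross u u = 0.
Proof. by rewrite /sqcross; ring. Qed.

Lemma sqcross0 u : sqcross (0, 0, 0) u = 0.
Proof. by rewrite /sqcross /=; ring. Qed.

(** This is the expansion u x (u x v) = (u . v) u - (u . u) v, read off in coordinates when the left
    side is zero. *)
Lemma sqcross_eq0 u v : sqcross u v = 0 ->
  [/\ dot3 u u * v.1.1 = dot3 u v * u.1.1, dot3 u u * v.1.2 = dot3 u v * u.1.2 &
      dot3 u u * v.2 = dot3 u v * u.2].
Proof.
rewrite /sqcross => /eqP; rewrite !paddr_eq0 ?addr_ge0 ?sqr_ge0 // !sqrf_eq0.
case/andP => /andP[/eqP h1 /eqP h2] /eqP h3; split; apply/eqP; rewrite -subr_eq0;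
  apply/eqP; rewrite /dot3.
- transitivity (u.2 * (u.2 * v.1.1 - u.1.1 * v.2)
     - u.1.2 * (u.1.1 * v.1.2 - u.1.2 * v.1.1)); first ring.
  by rewrite h2 h3 !mulr0 subrr.
- transitivity (u.1.1 * (u.1.1 * v.1.2 - u.1.2 * v.1.1)
     - u.2 * (u.1.2 * v.2 - u.2 * v.1.2)); first ring.
  by rewrite h1 h3 !mulr0 subrr.
- transitivity (u.1.2 * (u.1.2 * v.2 - u.2 * v.1.2)
     - u.1.1 * (u.2 * v.1.1 - u.1.1 * v.2)); first ring.
  by rewrite h1 h2 !mulr0 subrr.
Qed.

Lemma incidences_sqcross (V : finType) (v : V -> R * R * R) (M : R) L k :
  0 < M -> (forall b c, sqcross (v b) (v c) <= M) ->
  (forall b c, b != c -> sqcross (v b) (v c) != 0) ->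
  (0 < k)%N -> (#|V| <= 2 ^ L)%N -> (#|V| <= k ^ 3)%N ->
  (#|[set x : V * V | sqcross (v x.1) (v x.2) == M]|
     <= 2 ^ 14 * (1 + 2 * L) ^ 51 * k ^ 4)%N.
Proof.
move=> M0 le npar k0 VL Vk.
apply: (@incidences_le R V (fun b c => sqcross (v b) (v c))) => //.
- by move=> b c; rewrite sqcrossC.
- by move=> b; rewrite sqcrossvv.
by move=> rho; have [sg [p [K KP]]] := envelope_chart_exists rho npar; exists (sg, p, K).
Qed.

(** Selects one vector of each opposite pair: both define the same cylinder, whereas charts need
    pairwise non-parallel vectors. *)
Definition lexpos u :=
  (0 < u.1.1) || (u.1.1 == 0) && ((0 < u.1.2) || (u.1.2 == 0) && (0 < u.2)).
Definition opp3 u : R * R * R := (- u.1.1, - u.1.2, - u.2).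
Definition abs3 u := if lexpos u then u else opp3 u.

Lemma lexpos_opp u : u != (0, 0, 0) -> lexpos (opp3 u) = ~~ lexpos u.
Proof.
case: u => [[x y] z]; rewrite /lexpos /opp3 /= !oppr_eq0 !oppr_gt0.
case: (ltgtP x 0) => //= x0; case: (ltgtP y 0) => //= y0.
by case: (ltgtP z 0) => //= z0; rewrite x0 y0 z0 eqxx.
Qed.

Lemma sqcross_abs u v : sqcross (abs3 u) (abs3 v) = sqcross u v.
Proof.
by rewrite /abs3; case: (lexpos u); case: (lexpos v); rewrite /sqcross /opp3 /=; ring.
Qed.

Lemma opp3K u : opp3 (opp3 u) = u.
Proof. by case: u => [[x y] z]; rewrite /opp3 /= !opprK. Qed.

Lemma lexpos_abs u : u != (0, 0, 0) -> lexpos (abs3 u).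
Proof.
by move=> u0; rewrite /abs3; case: ifPn => // h; rewrite lexpos_opp.
Qed.

(** Parallelism gives [v = t * u]. Maximality of [M] yields [t ^+ 2 <= 1] through [w] and
    [t ^+ 2 >= 1] through [w'], and [lexpos] excludes [t = -1]. *)
Lemma parallel_lexpos u v w w' M : 0 < M -> sqcross u v = 0 ->
  sqcross u w = M -> sqcross v w' = M -> sqcross v w <= M -> sqcross u w' <= M ->
  lexpos u -> lexpos v -> u = v.
Proof.
move=> M0 /sqcross_eq0[h1 h2 h3] uw vw' vw uw' pu pv.
have u0 : dot3 u u != 0.
  by apply/eqP => /dot3_eq0 u0; move: M0; rewrite -uw u0 sqcross0 ltxx.
pose t := dot3 u v / dot3 u u.
have vE : v = (t * u.1.1, t * u.1.2, t * u.2).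
  rewrite /t; case: (v) h1 h2 h3 => [[x y] z] /= h1 h2 h3.
  by congr (_, _, _); apply: (mulfI u0); rewrite ?h1 ?h2 ?h3; field.
have sq s : sqcross v s = t ^+ 2 * sqcross u s by rewrite vE /sqcross /=; ring.
have t1 : t ^+ 2 = 1.
  apply/eqP; rewrite eq_le; apply/andP; split.
    by rewrite -(ler_pM2r M0) mul1r -{1}uw -sq.
  have t2 : 0 <= t ^+ 2 := sqr_ge0 t.
  have := ler_wpM2l t2 uw'; rewrite -sq vw' => h.
  by rewrite -(ler_pM2r M0) mul1r.
have /orP[/eqP tE|/eqP tE] : (t == 1) || (t == -1) by rewrite -sqrf_eq1 t1.
  by rewrite vE tE !mul1r; case: (u) => [[]].
have vN : v = opp3 u by rewrite vE tE /opp3 !mulN1r.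
have un0 : u != (0, 0, 0).
  by apply: contraNneq u0 => ->; rewrite /dot3 /= !mulr0 !addr0.
by move: pv; rewrite vN lexpos_opp // pu.
Qed.

Definition coord x : R * R * R := (x 0 0, x 0 1, x 0 2).

Lemma enorm_cross x y : enorm (cross x y) ^+ 2 = sqcross (coord x) (coord y).
Proof.
rewrite sqr_sqrtr; last by apply: sumr_ge0 => i _; apply: sqr_ge0.
rewrite !big_ord_recr big_ord0 /= add0r !mxE /sqcross /coord /=.
have i0 : widen_ord (leqnSn 2) (widen_ord (leqnSn 1) ord_max) = 0 :> 'I_3.
  exact/val_inj.
have i1 : widen_ord (leqnSn 2) ord_max = 1 :> 'I_3 by apply/val_inj.
have i2 : ord_max = 2 :> 'I_3 by apply/val_inj.
rewrite i0 i1 i2 add0r.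
have -> : (0 + 2 : 'I_3) = 2 by apply/val_inj.
have -> : (1 + 1 : 'I_3) = 2 by apply/val_inj.
have -> : (1 + 2 : 'I_3) = 0 by apply/val_inj.
have -> : (2 + 1 : 'I_3) = 0 by apply/val_inj.
have -> : (2 + 2 : 'I_3) = 1 by apply/val_inj.
by [].
Qed.

Lemma fset3_at (T : {fset 'rV[R]_3}) (a : 'rV[R]_3) : #|` T| = 3%N -> a \in T ->
  exists p q, T = [fset a; p; q]%fset /\ uniq [:: a; p; q].
Proof.
move=> T3 aT.
have T2 : #|` (T `\ a)%fset| = 2%N by have := cardfsD1 a T; rewrite aT T3 => -[].
have [T0|[p pT]] := fset_0Vmem (T `\ a)%fset; first by rewrite T0 cardfs0 in T2.
have : #|` (T `\ a `\ p)%fset| == 1%N.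
  by have := cardfsD1 p (T `\ a)%fset; rewrite pT T2 add1n => -[<-].
case/cardfs1P => q Tq; exists p, q; split.
  by rewrite -(fsetD1K aT) -(fsetD1K pT) Tq fsetUA.
have : q \in (T `\ a `\ p)%fset by rewrite Tq inE.
move: pT; rewrite !inE => /andP[pa _] /and3P[qp qa _].
by rewrite /= !inE negb_or andbT ![a == _]eq_sym pa qa eq_sym qp.
Qed.

Lemma coord0 : coord 0 = (0, 0, 0).
Proof. by rewrite /coord !mxE. Qed.

Lemma coordB0 x y : coord (x - y) = (0, 0, 0) -> x = y.
Proof.
case=> h0 h1 h2; apply/eqP; rewrite -subr_eq0; apply/eqP/rowP => i.
rewrite [RHS]mxE; case: i => [[|[|[|//]]] ilt].
- by rewrite -[RHS]h0; congr (_ _ _); apply/val_inj.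
- by rewrite -[RHS]h1; congr (_ _ _); apply/val_inj.
- by rewrite -[RHS]h2; congr (_ _ _); apply/val_inj.
Qed.

Lemma collinear_sqcross (a p q : 'rV[R]_3) :
  collinear [fset a; p; q]%fset -> sqcross (coord (p - a)) (coord (q - a)) = 0.
Proof.
case=> x [v vP].
have [|ta aE] := vP a; first by rewrite !inE eqxx.
have [|tp pE] := vP p; first by rewrite !inE eqxx orbT.
have [|tq qE] := vP q; first by rewrite !inE eqxx !orbT.
rewrite pE qE aE /sqcross /coord !mxE /=; ring.
Qed.

Lemma sqcross_collinear (a p q : 'rV[R]_3) :
  sqcross (coord (p - a)) (coord (q - a)) = 0 -> collinear [fset a; p; q]%fset.
Proof.
move=> h; have [pa|pa] := eqVneq p a.
  exists a, (q - a) => x; rewrite !inE pa -orbA => /or3P[]/eqP->.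
  - by exists 0; rewrite scale0r addr0.
  - by exists 0; rewrite scale0r addr0.
  - by exists 1; rewrite scale1r addrC subrK.
set u := coord (p - a) in h; set w := coord (q - a) in h.
have u0 : dot3 u u != 0 by apply: contra_neq pa => /dot3_eq0/coordB0.
have [h1 h2 h3] := sqcross_eq0 h.
exists a, (p - a) => x; rewrite !inE -orbA => /or3P[]/eqP->.
- by exists 0; rewrite scale0r addr0.
- by exists 1; rewrite scale1r addrC subrK.
exists (dot3 u w / dot3 u u).
have sol (s t : R) : dot3 u u * s = dot3 u w * t -> s = dot3 u w / dot3 u u * t.
  by move=> st; apply: (mulfI u0); rewrite st; field.
have {}h1 := sol _ _ h1; have {}h2 := sol _ _ h2; have {}h3 := sol _ _ h3.
suff E : q - a = (dot3 u w / dot3 u u) *: (p - a) by rewrite -E addrC subrK.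
apply/rowP => i; rewrite [RHS]mxE; case: i => [[|[|[|//]]] ilt].
- have -> : Ordinal ilt = 0 by apply/val_inj.
  exact: h1.
- have -> : Ordinal ilt = 1 by apply/val_inj.
  exact: h2.
- have -> : Ordinal ilt = 2 by apply/val_inj.
  exact: h3.
Qed.

Lemma max_area_triangles_at_le (S : {fset 'rV[R]_3}) (a : 'rV[R]_3) L k :
  a \in S -> (0 < k)%N -> (#|` S| <= 2 ^ L)%N -> (#|` S| <= k ^ 3)%N ->
  (#|` max_area_triangles_at S a| <= 4 * (2 ^ 14 * (1 + 2 * L) ^ 51 * k ^ 4))%N.
Proof.
move=> aS k0 SL Sk.
have memP T : T \in max_area_triangles_at S a -> max_area_triangle S T /\ a \in T.
  by rewrite !inE /= => /andP[_ /andP[/asboolP]].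
have [->|[T0 /memP[[tri0 max0] aT0]]] := fset_0Vmem (max_area_triangles_at S a).
  by rewrite cardfs0.
pose D x := coord (x - a); pose M := (2 * area T0) ^+ 2.
have area2_ge0 (T : {fset 'rV[R]_3}) : 0 <= 2 * area T.
  by rewrite /area /area3 mulr_ge0 // divr_ge0 // sqrtr_ge0.
have area_sq p q : uniq [:: a; p; q] ->
    sqcross (D p) (D q) = (2 * area [fset a; p; q]%fset) ^+ 2.
  move=> u3; rewrite area_fset3 // /area3 -enorm_cross.
  by congr (_ ^+ 2); rewrite mulrC divfK // pnatr_eq0.
have D_le p q : p \in S -> q \in S -> sqcross (D p) (D q) <= M.
  move=> pS qS; have [->|pq0] := eqVneq (sqcross (D p) (D q)) 0; first exact: sqr_ge0.
  have u3 : uniq [:: a; p; q].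
    rewrite /= !inE negb_or andbT -andbA; apply/and3P; split;
      apply: contraNneq pq0 => E; apply/eqP.
    + by rewrite -E /D subrr coord0 sqcross0.
    + by rewrite -E /D subrr coord0 sqcrossC sqcross0.
    + by rewrite -E sqcrossvv.
  have tri : triangle S [fset a; p; q]%fset.
    split.
    - by apply/fsubsetP => x; rewrite !inE -orbA => /or3P[]/eqP->.
    - move: u3; rewrite /= !inE negb_or andbT => /andP[/andP[ap aq] pq].
      by rewrite fsetUC cardfsU1 !inE negb_or ![q == _]eq_sym aq pq cardfs2 ap.
    - by move/collinear_sqcross => pq; rewrite /D pq eqxx in pq0.
  rewrite area_sq // /M; apply: lerXn2r; rewrite ?nnegrE ?area2_ge0 //.
  by rewrite ler_pM2l //; apply: max0.
have TM T : T \in max_area_triangles_at S a -> exists p q,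
    [/\ p \in S, q \in S, T = [fset a; p; q]%fset & sqcross (D p) (D q) = M].
  move=> /memP[[triT maxT] aT]; have [TS T3 _] := triT.
  have [p [q [TE u3]]] := fset3_at T3 aT; exists p, q; split => //.
  - by apply: (fsubsetP TS); rewrite TE !inE eqxx orbT.
  - by apply: (fsubsetP TS); rewrite TE !inE eqxx !orbT.
  - rewrite area_sq // -TE /M; congr ((_ * _) ^+ 2); apply/eqP; rewrite eq_le.
    by rewrite max0 // maxT.
have M0 : 0 < M.
  have [_ T3 ncol] := tri0; have [p [q [TE u3]]] := fset3_at T3 aT0.
  rewrite lt_def sqr_ge0 andbT /M TE -area_sq //; apply/eqP => h.
  by apply: ncol; rewrite TE; apply: sqcross_collinear.
pose E := [fset x in (S `*` S)%fset | sqcross (D x.1) (D x.2) == M]%fset.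
have ME : (#|` max_area_triangles_at S a| <= #|` E|)%N.
  pose f (x : 'rV[R]_3 * 'rV[R]_3) := [fset a; x.1; x.2]%fset.
  have fE : (#|` (f @` E)%fset| <= #|` E|)%N by apply: leq_imfset_card.
  apply: leq_trans fE.
  apply: fsubset_leq_card; apply/fsubsetP => T /TM[p [q [pS qS -> pqM]]].
  by apply/imfsetP; exists (p, q) => //=; rewrite !inE /= pS qS pqM eqxx.
apply: leq_trans ME _.
(* Only points with a partner at the maximum are kept; for these [parallel_lexpos] turns parallelism
   of the normalised vectors into equality. *)
pose N := [fset p in S | has (fun q => sqcross (D p) (D q) == M) S]%fset.
pose W := [fset abs3 (D p) | p in N]%fset.
have WS : (#|` W| <= #|` S|)%N.
  apply: leq_trans (leq_imfset_card _ _ _) _; apply: fsubset_leq_card.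
  by apply/fsubsetP => p; rewrite !inE => /andP[].
have WP (b : W) : exists p q, [/\ p \in S, q \in S, val b = abs3 (D p) &
    sqcross (D p) (D q) = M].
  have /imfsetP[p /=] := valP b; rewrite !inE => /andP[pS /hasP[q qS /eqP pq]] bE.
  by exists p, q.
have npar (b c : W) : b != c -> sqcross (val b) (val c) != 0.
  apply: contraNneq => bc0; apply/eqP/val_inj.
  have [p [q [pS qS bE pq]]] := WP b; have [p' [q' [p'S q'S cE pq']]] := WP c.
  rewrite bE cE in bc0 *.
  have nz x y : sqcross (D x) (D y) = M -> D x != (0, 0, 0).
    by move=> xy; apply/eqP => x0; move: M0; rewrite -xy x0 sqcross0 ltxx.
  apply: (@parallel_lexpos _ _ (abs3 (D q)) (abs3 (D q')) M); rewrite ?sqcross_abs //.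
  - by rewrite sqcross_abs in bc0.
  - exact: D_le.
  - exact: D_le.
  - by apply: lexpos_abs; apply: nz pq.
  - by apply: lexpos_abs; apply: nz pq'.
have W_le (b c : W) : sqcross (val b) (val c) <= M.
  have [p [q [pS qS -> pq]]] := WP b; have [p' [q' [p'S q'S -> pq']]] := WP c.
  by rewrite sqcross_abs D_le.
have cW : #|{: W}| = #|` W| by rewrite cardfE.
have := @incidences_sqcross W val M L k M0 W_le npar k0.
rewrite cW => /(_ (leq_trans WS SL) (leq_trans WS Sk)).
set I := [set x : W * W | _] => I_le.
(* A pair of booleans restores the two signs forgotten by [abs3]; this is the factor 4. *)
pose Z := finset.setX I [set: bool * bool].
have ZI : #|Z| = (4 * #|I|)%N.
  by rewrite cardsX cardsT card_prod card_bool mulnC.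
apply: (@leq_trans #|Z|); last by rewrite ZI leq_mul2l.
pose unD u : 'rV[R]_3 :=
  a + \row_(i < 3) (if i == 0 then u.1.1 else if i == 1 then u.1.2 else u.2).
have unDK x : unD (D x) = x.
  apply/rowP => i; rewrite !mxE /D /coord /=.
  case: i => [[|[|[|//]]] ilt] /=; rewrite !mxE addrC.
  - by rewrite (_ : Ordinal ilt = 0) ?subrK //; apply/val_inj.
  - by rewrite (_ : Ordinal ilt = 1) ?subrK //; apply/val_inj.
  - by rewrite (_ : Ordinal ilt = 2) ?subrK //; apply/val_inj.
pose sgn (s : bool) u := if s then u else opp3 u.
have sgnK x : sgn (lexpos (D x)) (abs3 (D x)) = D x.
  by rewrite /sgn /abs3; case: (lexpos _); rewrite ?opp3K.
pose h (y : W * W * (bool * bool)) :=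
  (unD (sgn y.2.1 (val y.1.1)), unD (sgn y.2.2 (val y.1.2))).
have hZ : (#|` [fset h y | y in Z]%fset| <= #|Z|)%N.
  by rewrite cardE; apply: leq_imfset_card.
apply: leq_trans hZ.
apply: fsubset_leq_card; apply/fsubsetP => -[p q].
rewrite !inE /= => /andP[/andP[pS qS] pq].
have inW x y : x \in S -> y \in S -> sqcross (D x) (D y) == M -> abs3 (D x) \in W.
  move=> xS yS xy; apply/imfsetP; exists x => //=; rewrite !inE xS /=.
  by apply/hasP; exists y.
have pW := inW _ _ pS qS pq.
have qW : abs3 (D q) \in W by apply: (inW _ _ qS pS); rewrite sqcrossC.
apply/imfsetP; exists (([` pW]%fset, [` qW]%fset), (lexpos (D p), lexpos (D q))).
  by rewrite /= !inE /= sqcross_abs pq.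
by rewrite /h /= !sgnK !unDK.
Qed.

End Reduction.

(** * From logarithms to powers of n *)

Lemma cube_root_bound n : (0 < n)%N -> exists2 k, (0 < k)%N & (n <= k ^ 3 <= 8 * n)%N.
Proof.
move=> n0; have ex : exists k, (n <= k ^ 3)%N.
  by exists n; rewrite -{1}(expn1 n) leq_pexp2l.
case: (ex_minnP ex) => -[|k] nk kmin.
  by rewrite exp0n // leqn0 in nk; rewrite (eqP nk) in n0.
exists k.+1 => //; rewrite nk /=.
have kn : (k ^ 3 < n)%N by rewrite ltnNge; apply/negP => /kmin; rewrite ltnn.
by case: k kn {nk kmin} => [|k] kn; [lia|rewrite !expnS !expn0 in kn *; nia].
Qed.

Lemma polylog_le_powR (R : realType) (eps : R) m : 0 < eps ->
  exists2 c : R, 0 <= c & forall n, (0 < n)%N ->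
    (1 + 2 * (trunc_log 2 n).+1)%:R ^+ m <= c * n%:R `^ eps.
Proof.
(* [d] makes [m.+1 * d * l] equal to [eps * ln (2 ^ l)], with [m.+1] keeping the denominator
   nonzero; [c] is such that [3 + 2 * l <= c * (1 + d * l)]. *)
move=> e0; pose d := eps * ln 2 / m.+1%:R; pose c := 3 + 2 / d.
have ln2 : 0 < ln 2 :> R by rewrite ln_gt0 // ltr1n.
have d0 : 0 < d by rewrite divr_gt0 // mulr_gt0.
have c0 : 0 <= c by rewrite addr_ge0 // divr_ge0 // ltW.
exists (c ^+ m); first exact: exprn_ge0.
move=> n n0; set l := trunc_log 2 n.
have ln_le : (2 ^ l <= n)%N by rewrite trunc_logP.
have step : (1 + 2 * l.+1)%:R <= c * expR (d * l%:R).
  apply: (@le_trans _ _ (c * (1 + d * l%:R))); last first.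
    by rewrite ler_wpM2l // expR_ge1Dx.
  have -> : c * (1 + d * l%:R) = 3 + 2 * l%:R + (2 / d + 3 * d * l%:R).
    by rewrite /c; field; rewrite gt_eqF.
  rewrite (_ : (1 + 2 * l.+1)%:R = 3 + 2 * l%:R :> R); last first.
    by rewrite natrD natrM -natr1; ring.
  by rewrite lerDl addr_ge0 // ?divr_ge0 ?mulr_ge0 // ltW.
apply: (@le_trans _ _ ((c * expR (d * l%:R)) ^+ m)).
  by rewrite lerXn2r // nnegrE // mulr_ge0 // expR_ge0.
rewrite exprMn ler_wpM2l ?exprn_ge0 // -expRM_natl.
apply: (@le_trans _ _ ((2 ^ l)%:R `^ eps)); last first.
  by rewrite ge0_ler_powR ?nnegrE ?ler0n ?ler_nat // ltW.
rewrite /powR natrX gt_eqF ?exprn_gt0 // lnXn // ler_expR.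
have -> : eps * (ln 2 *+ l) = m.+1%:R * (d * l%:R).
  by rewrite -[ln 2 *+ l]mulr_natr /d; field; rewrite ?nat1r ?natr1 pnatr_eq0.
by rewrite ler_wpM2r ?ler_nat // mulr_ge0 // ltW.
Qed.

Theorem theorem10 (R : realType) (eps : R) (eps_gt0 : 0 < eps) :
  exists C : R, forall (S : {fset 'rV[R]_3}) (a : 'rV[R]_3), a \in S ->
    #|` max_area_triangles_at S a|%:R <= C * #|` S|%:R `^ (4 / 3 + eps).
Proof.
have [c c0 cP] := polylog_le_powR 51 eps_gt0.
(* The last factor reflects [k ^ 3 <= 8 * n], [c] absorbs the 51st power of the logarithm, and the
   rest is the counting bound. *)
exists (4 * (2 ^+ 14 * c * 8 `^ (4 / 3))) => S a aS.
set n := #|` S|; have n0 : (0 < n)%N by rewrite cardfs_gt0; apply/fset0Pn; exists a.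
have [k k0 /andP[nk kn]] := cube_root_bound n0.
have nL : (n <= 2 ^ (trunc_log 2 n).+1)%N by rewrite ltnW // trunc_log_ltn.
have := max_area_triangles_at_le aS k0 nL nk.
rewrite -(ler_nat R) => /le_trans; apply.
have k4 : (k ^ 4)%:R <= 8 `^ (4 / 3) * n%:R `^ (4 / 3) :> R.
  rewrite -powRM ?ler0n // -natrM.
  apply: (@le_trans _ _ ((k ^ 3)%:R `^ (4 / 3))); last first.
    by rewrite ge0_ler_powR ?nnegrE ?ler0n ?ler_nat // divr_ge0.
  rewrite !natrX -!powR_mulrn ?ler0n // -powRrM.
  by rewrite (_ : 3%:R * (4 / 3) = 4%:R :> R) //; field.
rewrite powRD; last by rewrite pnatr_eq0 -lt0n n0 implybT.
rewrite 3!natrM natrX [((1 + _) ^ _)%:R]natrX.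
apply: (@le_trans _ _ (4 * (2 ^+ 14 * (c * n%:R `^ eps) *
    (8 `^ (4 / 3) * n%:R `^ (4 / 3))))).
  rewrite ler_wpM2l // ler_pM ?mulr_ge0 ?exprn_ge0 ?ler0n //.
  by rewrite ler_wpM2l ?exprn_ge0 // cP.
by rewrite le_eqVlt; apply/orP; left; apply/eqP; ring.
Qed.
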